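(* For every nonnegative integer $n$, \begin{align*} \overline{a}_5(5n+2) &= 4c_5(5n+1),\\ \overline{a}_5(5n+3) &= 4c_5(5n+2),\\ \overline{a}_5(10n+1) &= 2c_5(10n),\\ \overline{a}_5(10n+9) &= 2c_5(10n+8),\\ \overline{a}_5(20n+6) &= 10c_5(10n+2),\\ \overline{a}_5(20n+14) &= 10c_5(10n+6). \end{align*} Furthermore, for every nonnegative integer $n$ and every integer $k\geq 2$, $$\overline{a}_5(5^{k}n) = \left(\frac{5^{k} - 1}{4}\right)\overline{a}_5(5n) - \left(\frac{5^{k} - 5}{4}\right)\overline{a}_5(n).$$
   Context: For a partition $\lambda=(\lambda_1,\ldots,\lambda_m)$ of $n$ with conjugate parts $\lambda'_j$, the hook number of the node $(i,j)$ of its Ferrers--Young diagram is $\lambda_i+\lambda'_j-i-j+1$; $\lambda$ is a $5$-core if none of its hook numbers is divisible by $5$. $c_5(n)$ denotes the number of partitions of $n$ that are $5$-cores. With $f_j:=\prod_{k\ge 1}(1-q^{jk})$ (for $|q|<1$, or as a formal power series), its generating function is $\sum_{n\ge 0} c_5(n)q^n = f_5^5/f_1$ (a known identity). Let $\varphi(-q):=\sum_{n=-\infty}^{\infty}(-1)^n q^{n^2}=f_1^2/f_2$, so that $\varphi(-q^5)=f_5^2/f_{10}$. The integers $\overline{a}_5(n)$ are defined by $$\sum_{n=0}^\infty \overline{a}_5(n)q^n=\frac{\varphi^5(-q^5)}{\varphi(-q)}=1+2q+4q^2+8q^3+14q^4+14q^5+20q^6+24q^7+\cdots .$$ By convention $c_5(n)=\overline{a}_5(n)=0$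 for $n<0$. *)

(* Defs.v *)
From mathcomp Require Import all_boot all_order all_algebra.

Set Implicit Arguments.
Unset Strict Implicit.
Unset Printing Implicit Defensive.

Import Order.TTheory GRing.Theory Num.Theory.

Local Open Scope nat_scope.

Definition is_partition (n : nat) (s : seq nat) : bool :=
  [&& sorted geq s, 0 \notin s & sumn s == n].

(* Rows and columns are numbered from 1, as on paper. *)
Definition part (s : seq nat) (i : nat) : nat := nth 0 s i.-1.

Definition conj_part (s : seq nat) (j : nat) : nat := count (leq j) s.

(* At a node (i, j) of the diagram of a partition, i <= conj_part s j and
   j <= part s i, so the subtractions are not truncated there. *)
Definition hook (s : seq nat) (i j : nat) : nat :=
  part s i + conj_part s j - i - j + 1.

Definition is_core (t : nat) (s : seq nat) : bool :=
  all (fun i => all (fun j => ~~ (t %| hook s i j)) (iota 1 (part s i)))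
      (iota 1 (size s)).

Definition seq_of_bseq (n : nat) (s : n.-bseq 'I_n.+1) : seq nat :=
  map val (bseqval s).

(* A partition of n has at most n parts, each at most n, so it is counted
   inside a finite type; see [partition_bseq]. *)
Definition num_cores (t n : nat) : nat :=
  #|[set s : n.-bseq 'I_n.+1 |
      is_partition n (seq_of_bseq s) && is_core t (seq_of_bseq s)]|.

Definition c5 (n : nat) : nat := num_cores 5 n.

Lemma seq_of_bseq_inj n : injective (@seq_of_bseq n).
Proof. by move=> s1 s2 /(inj_map val_inj) /val_inj. Qed.

Lemma partition_bseq n s :
  is_partition n s -> exists b : n.-bseq 'I_n.+1, seq_of_bseq b = s.
Proof.
case/and3P=> _ s0 /eqP <-; set m := sumn s.
have le_part x : x \in s -> x <= m.
  rewrite /m; elim: s {s0 m} => //= y s IHs; rewrite inE => /predU1P[->|/IHs h].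
    exact: leq_addr.
  exact: leq_trans h (leq_addl _ _).
have le_size : size s <= m.
  rewrite /m; elim: s s0 {m le_part} => //= y s IHs.
  rewrite inE negb_or eq_sym -lt0n => /andP[y0 /IHs h].
  by rewrite -add1n leq_add.
have hs : size (map (@inord m) s) <= m by rewrite size_map.
exists (Bseq hs); rewrite /seq_of_bseq /= -map_comp -[RHS]map_id.
by apply/eq_in_map => x /le_part h /=; rewrite inordK.
Qed.

Local Open Scope ring_scope.

(* Formal power series in q over the integers, as coefficient sequences. *)
Definition series := nat -> int.

Definition series_one : series := fun n => (n == 0%N)%:R.

Definition series_mul (f g : series) : series :=
  fun n => \sum_(i < n.+1) f i * g (n - i)%N.

Definition series_exp (f : series) (k : nat) : series :=
  iter k (series_mul f) series_one.

(* f(q^d), for d > 0. *)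
Definition series_subst (d : nat) (f : series) : series :=
  fun n => if (d %| n)%N then f (n %/ d)%N else 0.

Fixpoint div_coefs (f g : series) (n : nat) : seq int :=
  if n is m.+1 then
    let s := div_coefs f g m in
    rcons s (f m - \sum_(i < m) s`_i * g (m - i)%N)
  else [::].

(* The quotient f / g when g has constant term 1; see [series_divK]. *)
Definition series_div (f g : series) : series :=
  fun n => (div_coefs f g n.+1)`_n.

Lemma size_div_coefs f g n : size (div_coefs f g n) = n.
Proof. by elim: n => //= n IHn; rewrite size_rcons IHn. Qed.

Lemma nth_div_coefs f g n i :
  (i < n)%N -> (div_coefs f g n)`_i = series_div f g i.
Proof.
elim: n => // n IHn; rewrite ltnS leq_eqVlt => /predU1P[-> //|lt_in].
by rewrite /= nth_rcons size_div_coefs lt_in IHn.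
Qed.

Lemma series_divK f g :
  g 0%N = 1 -> series_mul (series_div f g) g =1 f.
Proof.
move=> g0 n; rewrite /series_mul big_ord_recr /= subnn g0 mulr1.
rewrite {2}/series_div /= nth_rcons size_div_coefs ltnn eqxx.
rewrite [X in _ - X](eq_bigr (fun i : 'I_n => series_div f g i * g (n - i)%N)).
  by rewrite addrC subrK.
by move=> i _; rewrite nth_div_coefs.
Qed.

(* phi(-q): the coefficient of q^m is the sum of (-1)^z over the integers z
   with z^2 = m, all of which lie between -m and m. *)
Definition phi_neg : series := fun m =>
  \sum_(i < m.*2.+1 | (i%:Z - m%:Z) ^+ 2 == m%:Z) (-1) ^ (i%:Z - m%:Z).

(* The theta quotient phi(-q^5)^5 / phi(-q). *)
Definition abar5 : series :=
  series_div (series_exp (series_subst 5 phi_neg) 5) phi_neg.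

Lemma phi_neg0 : phi_neg 0%N = 1.
Proof. by rewrite /phi_neg big_mkcond big_ord_recl big_ord0. Qed.

Lemma abar5E :
  series_mul abar5 phi_neg =1 series_exp (series_subst 5 phi_neg) 5.
Proof. exact: series_divK phi_neg0. Qed.

(* Main.v *)
(** Write p = phi(-q), A = p(q^5), B = sum (-1)^n q^(5n^2+2n),
    D = sum (-1)^n q^(5n^2+4n), and let C, F be the generating functions of c_5
    and of the coefficients of A^5/p.  A 5-core of n is a point x of Z^5 with
    sum 0 and sum_i (5 x_i^2 + 2(i-2) x_i) = 2n, and a cyclic shift of Z^5 turns
    this into C(q^2) p = A B^2 D^2.  Multiplying by the same identity at -q gives
    (C p)^2 = (A^3 B D)^2, hence C p = A^3 B D.  As A^2 - p^2 = 4 q B D (count the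
    representations of 5n as a sum of two squares), we get
      4 q C = F - A^3 p   and   16 q^2 C(q^2) = F - 2 A^3 p + A p^3.
    The 5-dissection of p gives the coefficients of A^3 p and A p^3 in every
    residue class modulo 5, hence the first four identities; the last two also
    use the relation E(q) + E(-q) = 2 E(q^2) + 4 E(q^4) for E = q C.  Finally,
    extraction U of the exponents divisible by 5 maps A^3 p to A p^3 and A p^3 to
    6 A p^3 - 5 A^3 p, so that Z = U F - (5 F - 5 A^3 p + A p^3) satisfies
    Z = 4 Z(q^2), whence Z = 0 and U^2 F = 6 U F - 5 F. *)

Require Import Defs.
From HB Require Import structures.
From mathcomp Require Import all_boot all_order all_algebra.
From mathcomp Require Import boolp classical_sets fsbigop.
From mathcomp Require Import zify ring lra.

Set Implicit Arguments.
Unset Strict Implicit.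
Unset Printing Implicit Defensive.

Import Order.TTheory GRing.Theory Num.Theory.

Local Open Scope ring_scope.

(** * Formal power series over the integers *)

Record fps := Fps { coef : nat -> int }.

HB.instance Definition _ := gen_eqMixin fps.
HB.instance Definition _ := gen_choiceMixin fps.

Lemma fpsP (f g : fps) : coef f =1 coef g -> f = g.
Proof. by case: f g => f [g] /funext /= ->. Qed.

Definition fps_add f g := Fps (fun n => coef f n + coef g n).
Definition fps_opp f := Fps (fun n => - coef f n).
Definition fps_mul f g := Fps (series_mul (coef f) (coef g)).

Definition trunc (N : nat) (f : nat -> int) : {poly int} := \poly_(i < N) f i.

(** A coefficient of a product involves only coefficients of index at most its own, so every long
    enough truncation computes it. Commutativity and associativity are thus inherited from
    polynomials. *)
Lemma series_mulE N f g n :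
  (n < N)%N -> series_mul f g n = (trunc N f * trunc N g)`_n.
Proof.
move=> ltnN; rewrite coefM; apply: eq_bigr => i _.
have lei : (i <= n)%N by rewrite -ltnS.
by rewrite !coef_poly (leq_ltn_trans lei ltnN) (leq_ltn_trans (leq_subr _ _) ltnN).
Qed.

Lemma series_mulC f g : series_mul f g =1 series_mul g f.
Proof. by move=> n; rewrite !(series_mulE _ _ (ltnSn n)) mulrC. Qed.

Lemma coefM_eq (P P' R : {poly int}) n :
  (forall i, (i <= n)%N -> P`_i = P'`_i) -> (P * R)`_n = (P' * R)`_n.
Proof.
move=> eqP; rewrite !coefM; apply: eq_bigr => i _.
by rewrite eqP // -ltnS.
Qed.

Lemma series_mulA f g h :
  series_mul f (series_mul g h) =1 series_mul (series_mul f g) h.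
Proof.
move=> n; rewrite series_mulC !(series_mulE _ _ (ltnSn n)).
have trM u v i : (i <= n)%N ->
    (trunc n.+1 (series_mul u v))`_i = (trunc n.+1 u * trunc n.+1 v)`_i.
  by move=> lein; rewrite coef_poly ltnS lein (@series_mulE n.+1).
by rewrite (coefM_eq _ (trM g h)) (coefM_eq _ (trM f g)) mulrC mulrA.
Qed.

Lemma fps_addA : associative fps_add.
Proof. by move=> f g h; apply/fpsP => n; rewrite /= addrA. Qed.

Lemma fps_addC : commutative fps_add.
Proof. by move=> f g; apply/fpsP => n; rewrite /= addrC. Qed.

Lemma fps_add0 : left_id (Fps (fun=> 0)) fps_add.
Proof. by move=> f; apply/fpsP => n; rewrite /= add0r. Qed.

Lemma fps_addN : left_inverse (Fps (fun=> 0)) fps_opp fps_add.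
Proof. by move=> f; apply/fpsP => n; rewrite /= addNr. Qed.

HB.instance Definition _ :=
  GRing.isZmodule.Build fps fps_addA fps_addC fps_add0 fps_addN.

Lemma fps_mulA : associative fps_mul.
Proof. by move=> f g h; apply/fpsP => n; apply: series_mulA. Qed.

Lemma fps_mulC : commutative fps_mul.
Proof. by move=> f g; apply/fpsP => n; apply: series_mulC. Qed.

Lemma fps_mul1 : left_id (Fps series_one) fps_mul.
Proof.
move=> f; apply/fpsP => n /=.
rewrite /series_mul big_ord_recl subn0 /series_one mul1r big1 ?addr0 // => i _.
by rewrite mul0r.
Qed.

Lemma fps_mulDl : left_distributive fps_mul fps_add.
Proof.
move=> f g h; apply/fpsP => n /=; rewrite /series_mul -big_split /=.
by apply: eq_bigr => i _; rewrite mulrDl.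
Qed.

Lemma fps_1neq0 : Fps series_one != 0.
Proof. by apply/eqP => /(congr1 (fun f => coef f 0%N)). Qed.

HB.instance Definition _ := GRing.Zmodule_isComNzRing.Build fps
  fps_mulA fps_mulC fps_mul1 fps_mulDl fps_1neq0.

Arguments coef : simpl never.

Lemma coefD f g n : coef (f + g) n = coef f n + coef g n.
Proof. by []. Qed.

Lemma coefN f n : coef (- f) n = - coef f n.
Proof. by []. Qed.

Lemma coefB f g n : coef (f - g) n = coef f n - coef g n.
Proof. by []. Qed.

Lemma coef0 n : coef 0 n = 0.
Proof. by []. Qed.

Lemma coef1 n : coef 1 n = (n == 0%N)%:R.
Proof. by []. Qed.

Lemma coefMn f k n : coef (f *+ k) n = coef f n *+ k.
Proof. by elim: k => [|k IHk]; rewrite ?mulr0n // !mulrS coefD IHk. Qed.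

Lemma coef_mul f g n :
  coef (f * g) n = \sum_(i < n.+1) coef f i * coef g (n - i)%N.
Proof. by []. Qed.

Lemma coef_nat k n : coef k%:R n = k%:R *+ (n == 0%N).
Proof. by rewrite coefMn coef1; case: (n == 0%N); rewrite // mul0rn. Qed.

Lemma coef_natM k f n : coef (k%:R * f) n = k%:R * coef f n.
Proof. by rewrite mulr_natl coefMn mulr_natl. Qed.

Lemma coef_mul0 f g : coef (f * g) 0 = coef f 0 * coef g 0.
Proof. by rewrite coef_mul big_ord1. Qed.

Lemma coef_exp f k n : coef (f ^+ k) n = series_exp (coef f) k n.
Proof.
by rewrite /series_exp; elim: k n => // k IHk n; rewrite exprS coef_mul;
  apply: eq_bigr => i _; rewrite IHk.
Qed.

Lemma fps_neq0 (f : fps) n : coef f n != 0 -> f != 0.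
Proof. by apply: contra_neq => ->. Qed.

(** If m is the order of [f], the coefficient of q^(m+n) in f g reduces to f_m g_n once the earlier
    g_i are known to vanish. *)
Lemma fps_mulf_eq0 (f g : fps) : f != 0 -> f * g = 0 -> g = 0.
Proof.
move=> f0 fg0; apply/fpsP => n.
have ex_f : exists m, coef f m != 0.
  apply/not_existsP => f_eq0; move/eqP: f0; apply; apply/fpsP => m.
  by apply/eqP/negP => fm; apply: (f_eq0 m); apply/negP.
case: (ex_minnP ex_f) => m fm minm.
elim/ltn_ind: n => n IHn.
move/(congr1 (fun h => coef h (m + n)%N)): fg0; rewrite coef_mul coef0.
have ltm : (m < (m + n).+1)%N by rewrite ltnS leq_addr.
rewrite (bigD1 (Ordinal ltm)) //= addKn big1 => [|i ne_im].
  by move/eqP; rewrite addr0 mulf_eq0 (negPf fm) => /eqP.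
case: (ltngtP i m) => [lt_im|lt_mi|eq_im].
- suff /eqP -> : coef f i == 0 by rewrite mul0r.
  by apply: contraTT lt_im => /minm; rewrite -leqNgt.
- by rewrite IHn ?mulr0 //; case: i {ne_im} lt_mi => i /=; lia.
- by case/eqP: ne_im; apply: val_inj.
Qed.

Lemma fps_mulfI (f : fps) : f != 0 -> injective ( *%R f).
Proof.
move=> f0 g h /eqP; rewrite -subr_eq0 -mulrBr => /eqP /(fps_mulf_eq0 f0) /eqP.
by rewrite subr_eq0 => /eqP.
Qed.

(** * Multiplication by q^k and the substitutions of q^k and -q for q *)

Definition fpsX : fps := Fps (fun n => (n == 1%N)%:R).

Lemma coef_XnM k f n : coef (fpsX ^+ k * f) n =
  if (n < k)%N then 0 else coef f (n - k)%N.
Proof.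
elim: k n => [|k IHk] n; first by rewrite expr0 mul1r subn0.
rewrite exprS -mulrA; move: (_ * f) IHk => h IHk; rewrite coef_mul; case: n => [|n].
  by rewrite big_ord1 mul0r.
rewrite 2!big_ord_recl /= mul0r add0r mul1r /bump /= addn0 subSS subn0 IHk ltnS.
by rewrite big1 ?addr0 // => i _; rewrite mul0r.
Qed.

(* f(q^k); for k = 0 this is the constant term of f. *)
Definition dil (k : nat) (f : fps) : fps := Fps (series_subst k (coef f)).

Lemma coef_dil k f n : coef (dil k f) n =
  if (k %| n)%N then coef f (n %/ k)%N else 0.
Proof. by []. Qed.

Lemma coef_dilM k f n : (0 < k)%N -> coef (dil k f) (k * n) = coef f n.
Proof. by move=> k0; rewrite coef_dil dvdn_mulr // mulKn. Qed.

Lemma dil_inj k : (0 < k)%N -> injective (dil k).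
Proof.
by move=> k0 f g eqfg; apply/fpsP => n; rewrite -(coef_dilM f n k0) eqfg coef_dilM.
Qed.

Lemma dil_is_zmod_morphism k : zmod_morphism (dil k).
Proof.
move=> f g; apply/fpsP => n; rewrite coefB !coef_dil coefB.
by case: ifP; rewrite ?subr0.
Qed.

Lemma dil_is_monoid_morphism k : monoid_morphism (dil k).
Proof.
split.
  apply/fpsP => n; rewrite coef_dil !coef1.
  case: ifP => [|/negP]; case: k => [|k]; rewrite ?dvd0n.
  - by move=> /eqP ->.
  - by case/dvdnP=> m ->; rewrite mulnK // muln_eq0 orbF.
  - by case: n.
  - by case: n.
move=> f g; apply/fpsP => n; rewrite coef_dil.
(* For k = 0 the operator takes the constant term, which is multiplicative too. *)
case: k => [|k].
  rewrite dvd0n; case: n => [|n].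
    by rewrite eqxx divn0 !coef_mul0 !coef_dil dvd0n eqxx divn0.
  have -> : n.+1 == 0%N = false by [].
  rewrite coef_mul big1 // => i _; rewrite !coef_dil !dvd0n.
  case: eqP => [i0|]; last by rewrite mul0r.
  by rewrite i0 mulr0.
case: ifPn => [/dvdnP [m ->]|ndvd].
  rewrite mulnK // !coef_mul.
  rewrite -(big_mkord xpredT (fun i =>
    coef (dil _ f) i * coef (dil _ g) (m * k.+1 - i)%N)).
  rewrite (bigID (fun i => k.+1 %| i)%N) /= [X in _ + X]big1 ?addr0; last first.
    by move=> i /negPf ndvd; rewrite coef_dil ndvd mul0r.
  have -> : \sum_(0 <= i < (m * k.+1).+1 | (k.+1 %| i)%N)
      coef (dil k.+1 f) i * coef (dil k.+1 g) (m * k.+1 - i)%N =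
    \sum_(i <- [seq (k.+1 * j)%N | j <- iota 0 m.+1])
      coef (dil k.+1 f) i * coef (dil k.+1 g) (m * k.+1 - i)%N.
    rewrite -[LHS]big_filter; apply: perm_big; apply: uniq_perm.
    - by rewrite filter_uniq ?iota_uniq.
    - rewrite map_inj_uniq ?iota_uniq // => i j /eqP.
      by rewrite eqn_pmul2l // => /eqP.
    move=> i; rewrite mem_filter mem_index_iota; apply/andP/mapP.
      case=> /dvdnP [j ->] /=; rewrite ltnS leq_pmul2r // => lejm.
      by exists j; [rewrite inE mem_iota; lia | rewrite mulnC].
    case=> j; rewrite mem_iota add0n ltnS /= => lejm ->; rewrite dvdn_mulr //.
    by rewrite ltnS mulnC leq_pmul2r.
  rewrite big_map -[iota 0 m.+1]/(index_iota 0 m.+1) big_mkord.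
  apply: eq_bigr => i _.
  by rewrite [(m * _)%N]mulnC -mulnBr !coef_dilM.
rewrite coef_mul big1 // => i _; rewrite !coef_dil.
case: ifP => [dvdi|_]; last by rewrite mul0r.
case: ifP => [dvdni|_]; last by rewrite mulr0.
by case/negP: ndvd; rewrite -(subnK (_ : i <= n)%N) ?dvdn_add // -ltnS.
Qed.

HB.instance Definition _ k :=
  GRing.isZmodMorphism.Build fps fps (dil k) (dil_is_zmod_morphism k).
HB.instance Definition _ k :=
  GRing.isMonoidMorphism.Build fps fps (dil k) (dil_is_monoid_morphism k).

Lemma dil_dil j k f : dil j (dil k f) = dil (j * k)%N f.
Proof.
apply/fpsP => n; rewrite !coef_dil.
case: ifPn => [/dvdnP [m ->]|ndvd].
  case: j => [|j]; first by rewrite muln0 mul0n !divn0 div0n !dvdn0.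
  by rewrite mulnK // [(m * _)%N]mulnC dvdn_pmul2l // divnMl.
case: ifP => // /(dvdn_trans (dvdn_mulr k (dvdnn j))) dvdj.
by rewrite dvdj in ndvd.
Qed.

Lemma dil_X k : (0 < k)%N -> dil k fpsX = fpsX ^+ k.
Proof.
move=> k0; apply/fpsP => n; rewrite -[fpsX ^+ k]mulr1 coef_XnM coef_dil coef1.
rewrite [coef fpsX _]/((_ == 1%N)%:R); case: ifPn => [/dvdnP [m ->]|ndvd].
  rewrite mulnK //; case: ltnP => [lt_mk|le_km].
    by case: m lt_mk => [//|m]; rewrite mulSn ltnNge leq_addr.
  congr (_%:R); rewrite subn_eq0 -[in X in (_ <= X)%N](mul1n k) leq_pmul2r //.
  by case: m le_km => [|[|m]]; rewrite // mul0n leqNgt k0.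
case: ltnP => // lekn; case: eqP => // /eqP; rewrite subn_eq0 => lenk.
by move: ndvd; rewrite (@anti_leq n k) ?dvdnn // lenk.
Qed.

(* f(-q). *)
Definition alt (f : fps) : fps := Fps (fun n => (-1) ^+ n * coef f n).

Lemma coef_alt f n : coef (alt f) n = (-1) ^+ n * coef f n.
Proof. by []. Qed.

Lemma alt_is_zmod_morphism : zmod_morphism alt.
Proof. by move=> f g; apply/fpsP => n; rewrite coefB !coef_alt mulrBr. Qed.

Lemma alt_is_monoid_morphism : monoid_morphism alt.
Proof.
split; first by apply/fpsP => -[|n]; rewrite coef_alt !coef1 ?mulr0.
move=> f g; apply/fpsP => n; rewrite coef_alt !coef_mul mulr_sumr.
apply: eq_bigr => i _; rewrite !coef_alt mulrACA -exprD subnKC //.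
by rewrite -ltnS.
Qed.

HB.instance Definition _ :=
  GRing.isZmodMorphism.Build fps fps alt alt_is_zmod_morphism.
HB.instance Definition _ :=
  GRing.isMonoidMorphism.Build fps fps alt alt_is_monoid_morphism.

Lemma alt_dil2 f : alt (dil 2 f) = dil 2 f.
Proof.
apply/fpsP => n; rewrite coef_alt coef_dil; case: ifP; rewrite ?mulr0 //.
by case/dvdnP=> m ->; rewrite mulnC exprM sqrrN !expr1n mul1r.
Qed.

(** * Generating functions of weighted sets *)

(* The generating function of a weighted set: the coefficient of q^n is the
   sum of the c t over all t of weight n, and 0 when that sum is infinite. *)
Definition gen (T : choiceType) (w c : T -> int) : fps :=
  Fps (fun n => \sum_(t \in [set t | w t = n%:Z]%classic) c t).

(** Finiteness below each bound keeps the sums in [gen] away from their default value 0. A bound on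
    the weight, rather than its exact value, passes to products: each weight of a pair is at most
    their sum. *)
Definition proper (T : choiceType) (w : T -> int) :=
  (forall t, 0 <= w t) /\
  (forall n : nat, exists2 s : seq T, uniq s & forall t, w t <= n%:Z -> t \in s).

Lemma coef_gen (T : choiceType) (w c : T -> int) (s : seq T) n :
  uniq s -> (forall t, w t = n%:Z -> t \in s) ->
  coef (gen w c) n = \sum_(t <- s | w t == n%:Z) c t.
Proof.
move=> us sP; rewrite -big_filter fsbig_seq ?filter_uniq //.
rewrite -[LHS]/(\sum_(t \in [set t | w t = n%:Z]%classic) c t).
apply: eq_fsbigl; apply/seteqP; split=> t /=.
  by move=> wt; rewrite mem_filter wt eqxx sP.
by rewrite mem_filter => /andP[/eqP].
Qed.

Lemma eq_gen (T : choiceType) (w w' c c' : T -> int) :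
  w =1 w' -> c =1 c' -> gen w c = gen w' c'.
Proof. by move=> /funext -> /funext ->. Qed.

Lemma properP (T : choiceType) (w : T -> int) :
  (forall t, 0 <= w t) ->
  (forall n : nat, exists s : seq T, forall t, w t <= n%:Z -> t \in s) ->
  proper w.
Proof.
move=> w0 wf; split=> // n; have [s sP] := wf n.
by exists (undup s); [exact: undup_uniq | move=> t /sP; rewrite mem_undup].
Qed.

Lemma genD (T : choiceType) (w c d : T -> int) : proper w ->
  gen w (fun t => c t + d t) = gen w c + gen w d.
Proof.
case=> w0 wf; apply/fpsP => n; have [s us sP] := wf n.
by rewrite coefD !(coef_gen _ us) ?big_split // => t wt; apply: sP; rewrite wt.
Qed.

Lemma genN (T : choiceType) (w c : T -> int) : proper w ->
  gen w (fun t => - c t) = - gen w c.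
Proof.
case=> w0 wf; apply/fpsP => n; have [s us sP] := wf n.
by rewrite coefN !(coef_gen _ us) ?sumrN // => t wt; apply: sP; rewrite wt.
Qed.

(** The image of [f] contains the support of [c], so the other points contribute 0. Congruence
    conditions are encoded as zeros of [c] and removed by parametrising the points that satisfy
    them. *)
Lemma gen_reindex (T U : choiceType) (w c : T -> int) (f : U -> T) g :
  proper w -> cancel f g -> (forall t, c t != 0 -> f (g t) = t) ->
  gen w c = gen (fun u => w (f u)) (fun u => c (f u)).
Proof.
case=> w0 wf fK gK; apply/fpsP => n; have [s us sP] := wf n.
rewrite (coef_gen _ us) => [|t wt]; last by apply: sP; rewrite wt.
rewrite (@coef_gen _ _ _ [seq g t | t <- s & f (g t) == t]).
- rewrite big_map big_filter_cond (bigID (fun t => f (g t) == t)) /=.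
  rewrite [X in _ + X]big1 ?addr0 => [|t /andP[_]]; last first.
    by apply: contraNeq => /gK /eqP.
  apply: congr_big => // t; first by case: (f (g t) =P t) => [->|]; rewrite ?andbT ?andbF.
  by case/andP=> _ /eqP ->.
- rewrite map_inj_in_uniq ?filter_uniq // => t t'; rewrite !mem_filter.
  by case/andP=> /eqP ft _ /andP[/eqP ft' _] eqg; rewrite -ft eqg.
- move=> u wu; apply/mapP; exists (f u); rewrite ?fK //.
  by rewrite mem_filter fK eqxx sP ?wu.
Qed.

Lemma proper_prod (T U : choiceType) (w : T -> int) (v : U -> int) :
  proper w -> proper v -> proper (fun x : T * U => w x.1 + v x.2).
Proof.
case=> w0 wf [v0 vf]; apply: properP => [x|n]; first exact: addr_ge0.
have [s _ sP] := wf n; have [r _ rP] := vf n.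
exists (allpairs pair s r) => -[t u] /= le_n; apply/allpairsP; exists (t, u).
by split=> //=; [apply: sP | apply: rP]; apply: le_trans le_n;
  rewrite ?lerDl ?lerDr.
Qed.

Lemma genM (T U : choiceType) (w c : T -> int) (v d : U -> int) :
  proper w -> proper v ->
  gen w c * gen v d = gen (fun x : T * U => w x.1 + v x.2)
                          (fun x => c x.1 * d x.2).
Proof.
move=> pw pv; apply/fpsP => n; rewrite coef_mul.
have [w0 wf] := pw; have [v0 vf] := pv.
have [s us sP] := wf n; have [r ur rP] := vf n.
rewrite (@coef_gen _ _ _ [seq (t, u) | t <- s, u <- r]); first last.
- move=> [t u] /= eqn; apply/allpairsP; exists (t, u).
  by split=> //=; [apply: sP | apply: rP]; rewrite -eqn ?lerDl ?lerDr.
- by apply: allpairs_uniq => // -[a b] [a' b'].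
rewrite [RHS]big_mkcond big_allpairs /=.
under eq_bigr => i _.
  have lei : (i <= n)%N by rewrite -ltnS.
  rewrite (coef_gen _ us) => [|t wt]; last by apply: sP; rewrite wt lez_nat.
  rewrite (coef_gen _ ur) => [|t wt]; last first.
    by apply: rP; rewrite wt lez_nat leq_subr.
  rewrite mulr_suml; under eq_bigr do rewrite mulr_sumr.
  over.
rewrite (exchange_big_dep xpredT) //=; apply: eq_bigr => t _.
rewrite (exchange_big_dep xpredT) //=; apply: eq_bigr => u _.
have := w0 t; have := v0 u; case: (w t) => // a; case: (v u) => // b _ _.
rewrite -PoszD eqz_nat; case: eqP => [eqn|neqn].
  have lta : (a < n.+1)%N by rewrite ltnS -eqn leq_addr.
  rewrite (big_pred1 (Ordinal lta)) // => i; rewrite !eqz_nat.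
  have -> : pred1 (Ordinal lta) i = (i == a :> nat) by [].
  by have := ltn_ord i; lia.
rewrite big_pred0 // => i; rewrite !eqz_nat; have := ltn_ord i; lia.
Qed.

Lemma dil_gen k (T : choiceType) (w c : T -> int) : (0 < k)%N -> proper w ->
  dil k (gen w c) = gen (fun t => k%:Z * w t) c.
Proof.
move=> k0 [w0 wf]; apply/fpsP => n; rewrite coef_dil.
have [s us sP] := wf n.
rewrite [RHS](coef_gen _ us) => [|t kw]; last first.
  by apply: sP; rewrite -kw; have := w0 t; nia.
case: ifPn => [/dvdnP [m eqn]|ndvd].
  rewrite eqn mulnK // (coef_gen _ us) => [|t wt]; last first.
    by apply: sP; rewrite wt eqn; nia.
  by apply: eq_bigl => t; rewrite PoszM mulrC (inj_eq (mulIf _)) //; lia.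
rewrite big_pred0 // => t; apply/negP => /eqP kw; case/negP: ndvd.
have := w0 t; case: (w t) kw => // a kw _; apply/dvdnP; exists a; lia.
Qed.

Lemma XnM_gen k (T : choiceType) (w c : T -> int) : proper w ->
  fpsX ^+ k * gen w c = gen (fun t => w t + k%:Z) c.
Proof.
case=> [w0 wf]; apply/fpsP => n; rewrite coef_XnM.
have [s us sP] := wf n.
rewrite [RHS](coef_gen _ us) => [|t wt]; last by apply: sP; lia.
case: ltnP => [ltnk|lekn].
  by rewrite big_pred0 // => t; have := w0 t; lia.
rewrite (coef_gen _ us) => [|t wt]; last by apply: sP; rewrite wt lez_nat leq_subr.
by apply: eq_bigl => t; lia.
Qed.

(** * Signs *)

Definition sgp (z : int) : int := (-1) ^+ `|z|%N.

Lemma sgpE z : sgp z = (-1) ^ z.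
Proof.
case: z => // n; rewrite NegzE -exprnN /sgp abszN.
Qed.

Lemma sgpD x y : sgp (x + y) = sgp x * sgp y.
Proof. by rewrite !sgpE exprzDr ?unitrN1. Qed.

Lemma sgpN x : sgp (- x) = sgp x.
Proof. by rewrite /sgp abszN. Qed.

Lemma sgp_sqr x : sgp x * sgp x = 1.
Proof. by rewrite /sgp -signr_odd; case: odd. Qed.

Lemma sgp2 x : sgp (2 * x) = 1.
Proof. by rewrite mulr_natl mulr2n sgpD sgp_sqr. Qed.

Lemma sgp_eq k x y : x = y + 2 * k -> sgp x = sgp y.
Proof. by move=> ->; rewrite sgpD sgp2 mulr1. Qed.

Lemma alt_gen (T : choiceType) (w c : T -> int) : proper w ->
  alt (gen w c) = gen w (fun t => sgp (w t) * c t).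
Proof.
case=> [w0 wf]; apply/fpsP => n; rewrite coef_alt.
have [s us sP] := wf n.
have sP' t : w t = n%:Z -> t \in s by move=> wt; apply: sP; rewrite wt.
by rewrite !(coef_gen _ us sP') mulr_sumr; apply: eq_bigr => t /eqP ->.
Qed.

(** The involution turns the series into its own negative, and the integers have no 2-torsion. *)
Lemma gen_antisym (T : choiceType) (w c : T -> int) (f : T -> T) :
  proper w -> involutive f -> (forall t, w (f t) = w t) ->
  (forall t, c (f t) = - c t) -> gen w c = 0.
Proof.
move=> pw fK wf cf; have eqN : gen w c = - gen w c.
  rewrite -genN // (gen_reindex (f := f) (g := f)) => //.
  exact: eq_gen.
apply/fpsP => n; move/(congr1 (fun h => coef h n)): eqN.
rewrite coefN coef0; lia.
Qed.

(** * Theta series *)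

Lemma sgp_even x : (sgp x == 1) = (x == 2 * (x %/ 2)%Z).
Proof. by rewrite /sgp -signr_odd; case: (boolP (odd _)) => /=; lia. Qed.

Lemma sgp_odd x : sgp x != 1 -> sgp x = -1.
Proof. by rewrite /sgp -signr_odd; case: odd. Qed.

Lemma sgpM_self x : sgp (x * x) = sgp x.
Proof. by rewrite /sgp abszM -signr_odd oddM andbb signr_odd. Qed.

Lemma coef_gen_eq (T : choiceType) (w c c' : T -> int) n :
  (forall t, w t = n%:Z -> c t = c' t) -> coef (gen w c) n = coef (gen w c') n.
Proof. by move=> eqc; apply: eq_fsbigr => t; rewrite inE => /eqc. Qed.

Lemma eq_proper (T : choiceType) (w w' : T -> int) :
  w =1 w' -> proper w -> proper w'.
Proof. by move=> /funext ->. Qed.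

Definition thw (d i n : int) : int := d * n * n + i * n.

(** The series p, A, B, D of the overview are [theta 1 0], [theta 5 0], [theta 5 2] and
    [theta 5 4]. *)
Definition theta (d i : int) : fps := gen (thw d i) sgp.

(** As |i| <= d - 1 and |n| <= n^2, the linear term is at least -(d - 1) n^2. *)
Lemma thw_ge d i n : - d < i < d -> n * n <= thw d i n.
Proof.
case/andP=> lo hi.
suff : 0 <= (d - 1) * (n * n) + i * n by rewrite /thw; lia.
have h1 : 0 <= (d - 1) * (n * n - `|n|) by apply: mulr_ge0; nia.
have h2 : 0 <= (d - 1 - i) * (`|n| - n) by apply: mulr_ge0; lia.
have h3 : 0 <= (d - 1 + i) * (`|n| + n) by apply: mulr_ge0; lia.
by case: (leP 0 n) h1 h2 h3 => n0; nia.
Qed.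

Lemma proper_thw d i : - d < i < d -> proper (thw d i).
Proof.
move=> hi; have ge_n n := thw_ge n hi.
apply: properP => [n|N]; first by apply: le_trans (ge_n n); nia.
exists [seq k%:Z - N%:Z | k <- iota 0 N.*2.+1] => n /(le_trans (ge_n n)) le_nN.
have {le_nN} /andP[le_N le_n] : - N%:Z <= (n : int) <= N%:Z by move: le_nN; nia.
by apply/mapP; exists `|((n : int) + N%:Z)%R|%N; rewrite ?mem_iota; lia.
Qed.

Lemma theta_neg d i : - d < i < d -> theta d (- i) = theta d i.
Proof.
move=> hi; rewrite /theta; have pr : proper (thw d (- i)) by apply: proper_thw; lia.
rewrite (gen_reindex pr (f := -%R) (g := -%R)); [|exact: opprK|by move=> *; exact: opprK].
by apply: eq_gen => n; rewrite ?sgpN // /thw; ring.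
Qed.

Lemma dil_theta k d i : (0 < k)%N -> - d < i < d ->
  dil k (theta d i) = theta (k%:Z * d) (k%:Z * i).
Proof.
move=> k0 hi; rewrite /theta dil_gen //; last exact: proper_thw.
by apply: eq_gen => // n; rewrite /thw; ring.
Qed.

Lemma coef_theta0 d i : - d < i < d -> coef (theta d i) 0 = 1.
Proof.
move=> hi; have [t0 _] := proper_thw hi.
rewrite (@coef_gen _ _ _ [:: 0]) //; last first.
  by move=> n n0; rewrite inE; move: (thw_ge n hi); rewrite n0; nia.
by rewrite big_cons big_nil /thw !mulr0 addr0 eqxx.
Qed.

(** For d odd and i even the weight of n has the parity of n, so replacing q by -q removes the
    signs. In the product over pairs (m, n), those with m + n odd cancel under the swap; the others
    are m = a + b, n = a - b, where the weight separates into a part in a and a part in b. *)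
Lemma theta_alt d i e k : - d < i < d -> d = 2 * e + 1 -> i = 2 * k ->
  theta d i * alt (theta d i) = dil 2 (theta d i) * theta (2 * d) 0.
Proof.
move=> hi eqd eqi; have pr := proper_thw hi.
have pr0 : proper (thw (2 * d) 0) by apply: proper_thw; lia.
have pr2 : proper (fun n => 2%:Z * thw d i n).
  by apply: eq_proper (proper_thw (_ : - (2 * d) < 2 * i < 2 * d)) => [n|];
    rewrite /thw; [ring | lia].
rewrite /theta alt_gen // genM // dil_gen // genM //.
have sg_thw n : sgp (thw d i n) * sgp n = 1.
  rewrite (@sgp_eq (e * (n * n) + k * n) _ (n * n)) ?sgpM_self ?sgp_sqr //.
  by rewrite /thw eqd eqi; ring.
have prM := proper_prod pr pr.
under [in LHS]eq_gen => [x|x] do [over | rewrite sg_thw mulr1; over].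
(* [c true] keeps the pairs with even sum, [c false] those with odd sum. *)
pose c b (x : int * int) := if (sgp (x.1 + x.2) == 1) == b then sgp x.1 else 0.
rewrite (@eq_gen _ _ (fun x => thw d i x.1 + thw d i x.2) _
  (fun x => c true x + c false x)) => // [|x]; last first.
  by rewrite /c; case: (sgp _ == 1) => /=; rewrite ?addr0 ?add0r.
rewrite genD // [X in _ + X](gen_antisym (f := fun x => (x.2, x.1))) //; first last.
- move=> [m n]; rewrite /c /= (addrC n); case: (boolP (sgp (m + n) == 1)).
    by rewrite oppr0.
  by move=> /sgp_odd /=; rewrite sgpD => eqN;
    rewrite -[LHS]mul1r -(sgp_sqr m) -mulrA eqN mulrN1.
- by move=> [m n] /=; rewrite addrC.
- by case.
rewrite addr0 (gen_reindex (f := fun x => (x.1 + x.2, x.1 - x.2))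
  (g := fun y => (((y.1 + y.2) %/ 2)%Z, ((y.1 - y.2) %/ 2)%Z))) //.
- apply: eq_gen => [[a b]|[a b]] /=; first by rewrite /thw; ring.
  rewrite /c /= (_ : a + b + (a - b) = 2 * a) ?sgp2 ?sgpD //; ring.
- move=> [a b] /=; congr pair; lia.
- move=> [m n]; rewrite /c /= sgp_even eqb_id; case: (m + n =P _) => // mn _.
  by congr pair; lia.
Qed.

Lemma fps_phi_neg : Fps phi_neg = theta 1 0.
Proof.
apply/fpsP => m; rewrite (@coef_gen _ _ _ [seq k%:Z - m%:Z | k <- iota 0 m.*2.+1]).
- rewrite big_map -[iota _ _]/(index_iota 0 m.*2.+1) big_mkord.
  apply: eq_big => [i|i _]; last by rewrite sgpE.
  by rewrite /thw mul1r mul0r addr0 -expr2.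
- by rewrite map_inj_uniq ?iota_uniq // => i j /addIr [].
- move=> z; rewrite /thw mul1r mul0r addr0 => zm.
  apply/mapP; exists `|((z : int) + m%:Z)%R|%N; last by nia.
  by rewrite mem_iota; nia.
Qed.

(** * The 5-dissection of p and sums of two squares *)

(** Substitute n = e (5 m + r). The choice e = -1 treats the classes of 4 and 3 modulo 5 as the
    negatives of 1 and 2. *)
Lemma theta_1_0_residue e r : e * e = 1 -> 0 <= r < 5 ->
  gen (thw 1 0) (fun n => if ((e * n) %% 5)%Z == r then sgp n else 0) =
  gen (fun m => 25 * (m * m) + 10 * r * m + r * r) (fun m => sgp r * sgp m).
Proof.
move=> e1 hr; have pr : proper (thw 1 0) by apply: proper_thw.
have e_cases : e = 1 \/ e = -1 by nia.
rewrite (gen_reindex (f := fun m => e * (5 * m + r))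
  (g := fun n => ((e * n) %/ 5)%Z)) //.
- apply: eq_gen => m; first by rewrite /thw; case: e_cases => ->; ring.
  rewrite mulrA e1 mul1r (_ : ((5 * m + r) %% 5)%Z == r); last by apply/eqP; lia.
  have -> : sgp (e * (5 * m + r)) = sgp (r + m + 2 * (2 * m)).
    by case: e_cases => ->; rewrite ?mul1r ?mulN1r ?sgpN; congr sgp; ring.
  by rewrite sgpD sgp2 mulr1 sgpD.
- by move=> m; rewrite mulrA e1 mul1r; lia.
- by move=> n; case: (_ =P r) => // en _; case: e_cases en => ->; lia.
Qed.

(** For n = 5 m + r up to sign, n^2 = r^2 + 5 (5 m^2 + 2 r m) with r = 0, 1 or 2. The two signs of n
    give the factors 2, and the parity of r gives the sign of each term. *)
Lemma phi_dissection :
  theta 1 0 = dil 5 (theta 5 0) + fpsX * dil 5 (- (2%:R * theta 5 2))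
                + fpsX ^+ 4 * dil 5 (2%:R * theta 5 4).
Proof.
have pr : proper (thw 1 0) by apply: proper_thw.
pose c e r n : int := if ((e * n) %% 5)%Z == r then sgp n else 0.
have prI i : -5 < i < 5 -> proper (fun t => 5%:Z * thw 5 i t).
  move=> hi; apply: eq_proper (proper_thw (_ : - 25 < 5 * i < 25)); last lia.
  by move=> n; rewrite /thw; ring.
have term e r i k : e * e = 1 -> 0 <= r < 5 -> -5 < i < 5 -> i = 2 * r ->
    r * r = k%:Z -> gen (thw 1 0) (c e r) =
      fpsX ^+ k * gen (fun t => 5%:Z * thw 5 i t) (fun m => sgp r * sgp m).
  move=> e1 hr hi ei ek; rewrite theta_1_0_residue // XnM_gen; last exact: prI.
  by apply: eq_gen => m //; rewrite /thw ei -ek; ring.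
rewrite {1}/theta (@eq_gen _ _ (thw 1 0) _ (fun n =>
  c 1 0 n + (c 1 1 n + c (-1) 1 n) + (c 1 2 n + c (-1) 2 n))) //; last first.
  move=> n; rewrite /c mul1r mulN1r.
  have : exists2 r, (n %% 5)%Z = r & r \in [:: 0; 1; 2; 3; 4].
    by exists (n %% 5)%Z => //; rewrite !inE; lia.
  case=> r nr; rewrite !inE.
  have -> : ((- n) %% 5 == 1)%Z = (r == 4) by lia.
  have -> : ((- n) %% 5 == 2)%Z = (r == 3) by lia.
  rewrite nr; do 4![case/predU1P=> [->|]; first by rewrite /= ?addr0 ?add0r].
  by move/eqP->; rewrite /= ?addr0 ?add0r.
rewrite !genD //.
rewrite (term 1 0 0 0%N) // (term 1 1 2 1%N) // (term (-1) 1 2 1%N) //.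
rewrite (term 1 2 4 4%N) // (term (-1) 2 4 4%N) //.
have pr5 i : -5 < i < 5 -> proper (thw 5 i) by move=> hi; apply: proper_thw.
rewrite /theta !rmorphN !rmorphM !rmorph_nat /= !dil_gen //; try by apply: pr5.
have sg1 : sgp 1 = -1 by [].
have sgN i : -5 < i < 5 ->
    gen (fun t => 5%:Z * thw 5 i t) (fun m => sgp 1 * sgp m) =
    - gen (fun t => 5%:Z * thw 5 i t) sgp.
  move=> hi; rewrite -genN; last exact: prI.
  by apply: eq_gen => m //; rewrite sg1 mulN1r.
have sgE r i : sgp r = 1 ->
    gen (fun t => 5%:Z * thw 5 i t) (fun m => sgp r * sgp m) =
    gen (fun t => 5%:Z * thw 5 i t) sgp.
  by move=> r1; apply: eq_gen => m //; rewrite r1 mul1r.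
rewrite sgN // !sgE //; ring.
Qed.

Lemma coef_dissection (f0 f1 f2 f3 f4 : fps) r n : (r < 5)%N ->
  coef (dil 5 f0 + fpsX * dil 5 f1 + fpsX ^+ 2 * dil 5 f2
        + fpsX ^+ 3 * dil 5 f3 + fpsX ^+ 4 * dil 5 f4) (5 * n + r) =
  coef (nth 0 [:: f0; f1; f2; f3; f4] r) n.
Proof.
rewrite -[fpsX in fpsX * _]expr1 !coefD !coef_XnM !coef_dil => r5.
have term k f : (k < 5)%N -> (if (5 * n + r < k)%N then 0 else
    if (5 %| 5 * n + r - k)%N then coef f ((5 * n + r - k) %/ 5)%N else 0) =
    if k == r then coef f n else 0.
  move=> k5; case: ltnP => [lt_k|le_k]; first by case: eqP => //; lia.
  case: eqP => [->|ne_kr]; last by case: ifP => //; lia.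
  by rewrite addnK dvdn_mulr // mulKn.
rewrite -[X in (5 %| X)%N]subn0 -[X in (X %/ 5)%N]subn0.
have := term 0 f0 isT; rewrite ltn0 => ->; rewrite !term //.
by move: r r5 {term} => [|[|[|[|[|r]]]]] //= _; rewrite ?addr0 ?add0r.
Qed.

Lemma mod5_cases (a : int) :
  exists2 k : int, true & exists2 r : int, r \in [:: 0; 1; 2; 3; 4] & a = 5 * k + r.
Proof.
exists (a %/ 5)%Z => //; exists (a %% 5)%Z; rewrite ?inE; lia.
Qed.

(** If 5 divides a^2 + b^2, then a = 2 b or a = -2 b modulo 5, the latter being b = 2 a; both hold
    only when a and b vanish. This is inclusion-exclusion over the two cases. *)
Lemma sum_sqr_mod5 (a b z : int) : (exists m, a * a + b * b = 5 * m) ->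
  z = (if ((a - 2 * b) %% 5)%Z == 0 then z else 0)
      + (if ((b - 2 * a) %% 5)%Z == 0 then z else 0)
      - (if ((a %% 5)%Z == 0) && ((b %% 5)%Z == 0) then z else 0).
Proof.
case=> m; case: (mod5_cases a) => k _ [r hr ->]; case: (mod5_cases b) => l _ [t ht ->].
have -> : (((5 * k + r - 2 * (5 * l + t)) %% 5)%Z == 0) = (((r - 2 * t) %% 5)%Z == 0).
  lia.
have -> : (((5 * l + t - 2 * (5 * k + r)) %% 5)%Z == 0) = (((t - 2 * r) %% 5)%Z == 0).
  lia.
have -> : (((5 * k + r) %% 5)%Z == 0) = (r == 0) by move: hr; rewrite !inE; lia.
have -> : (((5 * l + t) %% 5)%Z == 0) = (t == 0) by move: ht; rewrite !inE; lia.
have -> : (5 * k + r) * (5 * k + r) + (5 * l + t) * (5 * l + t) =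
  5 * (5 * k * k + 2 * k * r + 5 * l * l + 2 * l * t) + (r * r + t * t) by ring.
move: (5 * k * k + _ + _ + _) => y.
by move: hr ht; rewrite !inE => /or4P[|||/orP[]] /eqP -> /or4P[|||/orP[]] /eqP ->;
  rewrite /= ?addr0 ?subr0 ?addrK ?add0r //; lia.
Qed.

Lemma theta_5_0 : theta 5 0 = dil 5 (theta 1 0).
Proof. by rewrite dil_theta // mulr1 mulr0. Qed.

(* Among the representations of a multiple of 5 as a^2 + b^2, those with
   a = 2b and those with a = -2b modulo 5 each correspond to the Gaussian
   integers, through multiplication by 2 + i and 2 - i. *)
Lemma coef_phi_sqr n :
  coef (theta 1 0 * theta 1 0) (5 * n) =
  coef (2%:R * (theta 1 0 * theta 1 0) - theta 5 0 * theta 5 0) n.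
Proof.
have pr : proper (thw 1 0) by apply: proper_thw.
have prM := proper_prod pr pr.
pose W (x : int * int) := thw 1 0 x.1 + thw 1 0 x.2.
have WE x : W x = x.1 * x.1 + x.2 * x.2.
  by rewrite /W /thw; ring.
pose c (P : int -> int -> bool) (x : int * int) :=
  if P x.1 x.2 then sgp x.1 * sgp x.2 else 0.
pose P1 (a b : int) := ((a - 2 * b) %% 5 == 0)%Z.
pose P2 (a b : int) := ((b - 2 * a) %% 5 == 0)%Z.
pose P0 (a b : int) := ((a %% 5 == 0) && (b %% 5 == 0))%Z.
have -> : coef (theta 1 0 * theta 1 0) (5 * n) =
          coef (gen W (fun x => c P1 x + c P2 x - c P0 x)) (5 * n).
  rewrite /theta genM //; apply: coef_gen_eq => -[a b]; rewrite -/(W _) WE /c /=.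
  by move=> ab; apply: sum_sqr_mod5; exists n%:Z; rewrite ab PoszM.
have reidx (P : int -> int -> bool) (f g : int * int -> int * int) :
    cancel f g -> (forall x, P x.1 x.2 -> f (g x) = x) ->
    (forall x, P (f x).1 (f x).2) -> (forall x, W (f x) = 5 * W x) ->
    (forall x, sgp (f x).1 * sgp (f x).2 = sgp x.1 * sgp x.2) ->
    gen W (c P) = dil 5 (theta 1 0 * theta 1 0).
  move=> fK gK Pf Wf sf; rewrite /theta genM // dil_gen //.
  rewrite (gen_reindex (f := f) (g := g)) //.
    by apply: eq_gen => x; rewrite ?Wf // /c Pf sf.
  by move=> x; rewrite /c; case: ifP => [/gK|//].
have reidx0 : gen W (c P0) = dil 5 (theta 5 0 * theta 5 0).
  rewrite theta_5_0 -rmorphM dil_dil /theta genM // dil_gen //.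
  rewrite (gen_reindex (f := fun x => (5 * x.1, 5 * x.2))
     (g := fun x => ((x.1 %/ 5)%Z, (x.2 %/ 5)%Z))) //.
  - apply: eq_gen => -[a b]; first by rewrite WE /thw /=; ring.
    rewrite /c /P0 /= (_ : (_ && _)); last lia.
    by rewrite (@sgp_eq (2 * a) (5 * a) a) ?(@sgp_eq (2 * b) (5 * b) b) //; ring.
  - by move=> [a b] /=; congr pair; lia.
  - move=> [a b]; rewrite /c /P0 /=; case: (boolP (_ && _)) => // ab _.
    by congr pair; lia.
rewrite !genD // genN // reidx0.
(* This map is (2 + i)(a + b i), of norm 5 times that of a + b i. *)
rewrite (reidx P1 (fun x => (2 * x.1 - x.2, x.1 + 2 * x.2))
   (fun x => (((2 * x.1 + x.2) %/ 5)%Z, ((2 * x.2 - x.1) %/ 5)%Z))).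
(* The same map followed by the exchange of the two coordinates. *)
- rewrite (reidx P2 (fun x => (x.1 + 2 * x.2, 2 * x.1 - x.2))
   (fun x => (((2 * x.2 + x.1) %/ 5)%Z, ((2 * x.1 - x.2) %/ 5)%Z))).
  + by rewrite -!rmorphD -rmorphB coef_dilM // mulr_natl mulr2n.
  + by move=> [a b] /=; congr pair; lia.
  + by move=> [a b]; rewrite /P2 /= => ab; congr pair; lia.
  + by move=> [a b]; rewrite /P2 /=; lia.
  + by move=> [a b]; rewrite !WE /=; ring.
  + move=> [a b] /=; rewrite -!sgpD (sgp_eq (k := a) (y := a + b)) //; ring.
- by move=> [a b] /=; congr pair; lia.
- by move=> [a b]; rewrite /P1 /= => ab; congr pair; lia.
- by move=> [a b]; rewrite /P1 /=; lia.
- by move=> [a b]; rewrite !WE /=; ring.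
- move=> [a b] /=; rewrite -!sgpD (sgp_eq (k := a) (y := a + b)) //; ring.
Qed.

(** Squaring the dissection of p and extracting the exponents divisible by 5 gives A^2 - 8 q B D;
    [coef_phi_sqr] evaluates the same extraction as 2 p^2 - A^2. *)
Lemma phi_sqr :
  theta 5 0 * theta 5 0 - theta 1 0 * theta 1 0 =
  4%:R * fpsX * theta 5 2 * theta 5 4.
Proof.
set p := theta 1 0; set A := theta 5 0; set B := theta 5 2; set D := theta 5 4.
have key : 2%:R * (p * p) - A * A = A * A - 8%:R * fpsX * B * D.
  apply/fpsP => n; rewrite -coef_phi_sqr.
  have -> : theta 1 0 * theta 1 0 =
      dil 5 (A * A - 8%:R * fpsX * B * D) + fpsX * dil 5 (- (4%:R * A * B))
      + fpsX ^+ 2 * dil 5 (4%:R * B * B) + fpsX ^+ 3 * dil 5 (4%:R * fpsX * D * D)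
      + fpsX ^+ 4 * dil 5 (4%:R * A * D).
    rewrite phi_dissection !(rmorphB, rmorphN, rmorphM, rmorph_nat) /= !dil_X //.
    by rewrite -/A -/B -/D; ring.
  by rewrite -[(5 * n)%N]addn0 coef_dissection.
have eq2 : 2%:R * (A * A - p * p - 4%:R * fpsX * B * D) = 0.
  by apply/eqP; move/eqP: key; rewrite -subr_eq0 -oppr_eq0; congr (_ == _); ring.
apply/eqP; rewrite -subr_eq0; apply/eqP/fpsP => n.
by move/(congr1 (fun f => coef f n)): eq2; rewrite coef_natM coef0 => /eqP;
  rewrite mulf_eq0 => /eqP.
Qed.

(** * Lattice points and the cyclic shift *)

Definition Z5 : choiceType := (int * int * int * int * int)%type.

Definition tot (t : Z5) : int := let: (a, b, c, d, e) := t in a + b + c + d + e.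

(** Twice the Garvan-Kim-Stanton quadratic form: at the point of sum 0 attached to a 5-core, it is
    twice the size of the core. *)
Definition core_form (t : Z5) : int := let: (a, b, c, d, e) := t in
  5 * (a * a + b * b + c * c + d * d + e * e) + (4 * e + 2 * d - 2 * b - 4 * a).

(* In the coordinates 5 t_i + i - 2 this is a rotation followed by the
   subtraction of 1 from each coordinate. *)
Definition cyc (t : Z5) : Z5 := let: (a, b, c, d, e) := t in (b, c, d, e, a - 1).
Definition cycV (t : Z5) : Z5 := let: (a, b, c, d, e) := t in (e + 1, a, b, c, d).

Lemma cycK : cancel cyc cycV.
Proof. by move=> [[[[a b] c] d] e]; rewrite /= subrK. Qed.

Lemma cycVK : cancel cycV cyc.
Proof. by move=> [[[[a b] c] d] e]; rewrite /= addrK. Qed.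

Lemma tot_cyc t : tot (cyc t) = tot t - 1.
Proof. by case: t => [[[[a b] c] d] e] /=; ring. Qed.

(** In the coordinates y_i = 5 t_i + i - 2, whose sum is 5 [tot t], five times this quantity plus 10
    is the sum of squared deviations of the y_i from their mean, which rotations and translations
    preserve. *)
Lemma core_form_cyc t :
  core_form (cyc t) - tot (cyc t) ^+ 2 = core_form t - tot t ^+ 2.
Proof. by case: t => [[[[a b] c] d] e] /=; ring. Qed.

Definition cycz (m : int) (t : Z5) : Z5 :=
  match m with Posz n => iter n cyc t | Negz n => iter n.+1 cycV t end.
Definition cyczV (m : int) (t : Z5) : Z5 :=
  match m with Posz n => iter n cycV t | Negz n => iter n.+1 cyc t end.

Lemma iter_can (T : Type) (f g : T -> T) n : cancel f g -> cancel (iter n f) (iter n g).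
Proof. by move=> fK; elim: n => // n IHn x; rewrite iterSr /= fK IHn. Qed.

Lemma cyczK m : cancel (cycz m) (cyczV m).
Proof.
case: m => n; first exact: (iter_can n cycK).
exact: (iter_can n.+1 cycVK).
Qed.

Lemma cyczVK m : cancel (cyczV m) (cycz m).
Proof.
case: m => n; first exact: (iter_can n cycVK).
exact: (iter_can n.+1 cycK).
Qed.

Lemma tot_iter_cyc n t : tot (iter n cyc t) = tot t - n%:Z.
Proof. by elim: n => [|n IHn]; rewrite ?subr0 //= tot_cyc IHn; lia. Qed.

Lemma core_form_iter_cyc n t :
  core_form (iter n cyc t) - tot (iter n cyc t) ^+ 2 = core_form t - tot t ^+ 2.
Proof. by elim: n => //= n IHn; rewrite core_form_cyc. Qed.

Lemma tot_cycz m t : tot (cycz m t) = tot t - m.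
Proof.
case: m => n; first exact: tot_iter_cyc.
have := tot_iter_cyc n.+1 (iter n.+1 cycV t).
by rewrite -[in LHS]/(cycz (Negz n) t) (iter_can n.+1 cycVK) /cycz NegzE; lia.
Qed.

Lemma core_form_cycz m t :
  core_form (cycz m t) - tot (cycz m t) ^+ 2 = core_form t - tot t ^+ 2.
Proof.
case: m => n; first exact: core_form_iter_cyc.
have := core_form_iter_cyc n.+1 (iter n.+1 cycV t).
by rewrite (iter_can n.+1 cycVK).
Qed.

Definition core_series : fps := gen core_form (fun t => (tot t == 0)%:R).

(** The weight is the sum of the [thw 5 i] for i = -4, -2, 0, 2, 4, one per coordinate, so the
    series factors; i and -i give the same theta series. *)
Lemma theta_prod :
  theta 5 0 * theta 5 2 ^+ 2 * theta 5 4 ^+ 2 = gen core_form (fun t => sgp (tot t))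
  /\ proper core_form.
Proof.
have pr i : - 5 < i < 5 -> proper (thw 5 i) by apply: proper_thw.
have := proper_prod (proper_prod (proper_prod (proper_prod (pr (- 4) isT)
   (pr (- 2) isT)) (pr 0 isT)) (pr 2 isT)) (pr 4 isT).
have p1 := proper_prod (pr (- 4) isT) (pr (- 2) isT).
have p2 := proper_prod p1 (pr 0 isT); have p3 := proper_prod p2 (pr 2 isT).
move=> p4; split; last first.
  by apply: eq_proper p4 => -[[[[a b] c] d] e] /=; rewrite /thw; ring.
have -> : theta 5 0 * theta 5 2 ^+ 2 * theta 5 4 ^+ 2 =
    theta 5 (- 4) * theta 5 (- 2) * theta 5 0 * theta 5 2 * theta 5 4.
  by rewrite !theta_neg //; ring.
rewrite /theta (genM _ _ (pr (- 4) isT) (pr (- 2) isT)).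
rewrite (genM _ _ p1 (pr 0 isT)) (genM _ _ p2 (pr 2 isT)) (genM _ _ p3 (pr 4 isT)).
apply: eq_gen => -[[[[a b] c] d] e] /=; first by rewrite /thw; ring.
by rewrite !sgpD.
Qed.

(* The shift cyc lowers the sum of the coordinates by 1 and keeps
   core_form - tot^2, so that a point t of Z^5 is encoded by tot t together
   with its shift of sum 0. *)
Lemma core_series_phi :
  core_series * theta 1 0 = theta 5 0 * theta 5 2 ^+ 2 * theta 5 4 ^+ 2.
Proof.
have [-> pr] := theta_prod; have pr1 : proper (thw 1 0) by apply: proper_thw.
rewrite /core_series /theta genM //.
rewrite (gen_reindex (f := fun t => (cycz (tot t) t, tot t))
  (g := fun x => cyczV x.2 x.1)).
- apply: eq_gen => t /=.
    have := core_form_cycz (tot t) t; rewrite tot_cycz subrr /thw; lia.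
  by rewrite tot_cycz subrr eqxx mul1r.
- exact: proper_prod.
- by move=> t; rewrite /= cyczK.
move=> [t m] /=; have := tot_cycz m (cyczV m t); rewrite cyczVK.
case: (tot t =P 0) => [-> /eqP|]; last by rewrite mul0r.
by rewrite eq_sym subr_eq0 => /eqP -> _; rewrite cyczVK.
Qed.

Local Open Scope nat_scope.

(** * 5-cores as lattice points *)

Lemma geq_trans : transitive geq.
Proof. by move=> m n p /= h1 h2; apply: leq_trans h2 h1. Qed.

Lemma gtn_trans : transitive gtn.
Proof. by move=> m n p /= h1 h2; apply: ltn_trans h2 h1. Qed.

Lemma sorted_geq_nth s i j : sorted geq s -> i <= j -> nth 0 s j <= nth 0 s i.
Proof.
move=> ss leij; case: (ltnP j (size s)) => [ltj|le_j]; last by rewrite nth_default.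
have := sorted_leq_nth geq_trans leqnn 0 ss; apply; rewrite ?inE //.
exact: leq_ltn_trans ltj.
Qed.

(** Both sides say that the diagram contains the node in row l and column j, counted from 0. *)
Lemma ltn_nth_conj s j l : sorted geq s ->
  (j < nth 0 s l) = (l < count (leq j.+1) s).
Proof.
elim: s l => [|x s IHs] l; first by rewrite nth_nil ltn0.
move=> /= ps; have ss := path_sorted ps.
have count0 : x <= j -> count (leq j.+1) s = 0.
  move=> lexj; apply/eqP; rewrite -leqn0 leqNgt -has_count; apply/hasPn => y ys.
  have /allP/(_ y ys) := order_path_min geq_trans ps; rewrite /= -ltnNge ltnS => h.
  exact: leq_trans h lexj.
case: l => [|l] /=; first by case: (ltnP j x) => // /count0 ->.
rewrite IHs //; case: (ltnP j x) => [|/count0 ->]; first by rewrite add1n ltnS.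
by rewrite ltn0.
Qed.

(* The first-column hook lengths of s padded with zeros to N parts. *)
Definition beta (N : nat) (s : seq nat) : seq nat :=
  mkseq (fun i => nth 0 s i + (N - i.+1)) N.

Lemma size_beta N s : size (beta N s) = N.
Proof. exact: size_mkseq. Qed.

Lemma nth_beta N s i : i < N -> nth 0 (beta N s) i = nth 0 s i + (N - i.+1).
Proof. by move=> ltiN; rewrite nth_mkseq. Qed.

Lemma mem_beta N s v :
  reflect (exists2 i, i < N & v = nth 0 s i + (N - i.+1)) (v \in beta N s).
Proof.
apply: (iffP mapP) => [[i]|[i ltiN ->]]; first by rewrite mem_iota => ? ->; exists i.
by exists i; rewrite ?mem_iota.
Qed.

Lemma beta_sorted N s : sorted geq s -> sorted gtn (beta N s).
Proof.
move=> ss; apply/(sortedP 0) => i; rewrite size_beta => ltiN /=.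
rewrite !nth_beta //; last exact: ltnW.
by have := sorted_geq_nth ss (leqnSn i); lia.
Qed.

Lemma gtn_sorted_uniq X : sorted gtn X -> uniq X.
Proof. by apply: (sorted_uniq gtn_trans) => n; rewrite /= ltnn. Qed.

(* N + j - conj_part s j.+1 are the gaps of beta N s; the hook at (i, j) is the
   difference between the i-th element and the j-th gap. *)
Lemma beta_gap N s j : sorted geq s -> size s <= N ->
  N + j - count (leq j.+1) s \notin beta N s.
Proof.
move=> ss leN; apply/mem_beta => -[l ltlN].
have := ltn_nth_conj j l ss; have := count_size (leq j.+1) s.
by case: (ltnP l) => h1; case: (ltnP j) => h2; lia.
Qed.

(** A missing [v] lies between the beta numbers of two consecutive rows l - 1 and l, so exactly l
    rows reach past column v + l - N; that column is the required j. *)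
Lemma beta_gapP N s i v : sorted geq s -> size s <= N ->
  i < N -> v < nth 0 s i + (N - i.+1) -> v \notin beta N s ->
  exists2 j, j < nth 0 s i & v = N + j - count (leq j.+1) s.
Proof.
move=> ss leN ltiN lt_v vN.
have ex_l : exists l, nth 0 s l + (N - l.+1) <= v.
  by exists N; rewrite nth_default //; lia.
(* [l] is the first row whose beta number is at most [v]; the empty row N ensures that one
   exists. *)
case: (ex_minnP ex_l) => l le_lv min_l.
have le_lN : l <= N by apply: min_l; rewrite nth_default //; lia.
have lt_il : i < l.
  by rewrite ltnNge; apply/negP => le_li; have := sorted_geq_nth ss le_li; lia.
have lt_v' : v < nth 0 s l.-1 + (N - l).
  by rewrite ltnNge; apply/negP => le_v; have := min_l l.-1; rewrite prednK; lia.
have lt_lv : N <= l \/ nth 0 s l + (N - l.+1) < v.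
  case: (ltnP l N) => [ltlN|]; [right | by left].
  rewrite ltn_neqAle le_lv andbT; apply/eqP => eq_v.
  by case/mem_beta: vN; exists l.
have nth_lN : N <= l -> nth 0 s l = 0 by move=> leNl; rewrite nth_default //; lia.
have count_l : count (leq (v + l - N).+1) s = l.
  have := ltn_nth_conj (v + l - N) l.-1 ss; have := ltn_nth_conj (v + l - N) l ss.
  case: lt_lv => [leNl|lt_lv]; first by rewrite nth_lN //; lia.
  by move: lt_lv lt_v' lt_il le_lN; clear; lia.
exists (v + l - N); last by rewrite count_l; case: lt_lv; lia.
have := sorted_geq_nth ss (_ : i <= l.-1); have := nth_lN; lia.
Qed.

(** On the abacus with five runners, all beads are pushed to the start of their runner. *)
Definition closed5 (X : seq nat) := forall b, b + 5 \in X -> b \in X.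

(** Hooks are differences between a beta number and a smaller gap. A failure of closedness at b is a
    hook of length 5; conversely steps of 5 inside a closed set never reach a gap. *)
Lemma is_core_closed N s : sorted geq s -> size s <= N ->
  is_core 5 s <-> closed5 (beta N s).
Proof.
move=> ss leN; have node i j : i < size s -> j < nth 0 s i ->
    hook s i.+1 j.+1 + (N + j - count (leq j.+1) s) = nth 0 s i + (N - i.+1).
  move=> lti ltj; rewrite /hook /part /conj_part /=.
  have := ltn_nth_conj j i ss; rewrite ltj => /esym.
  have := count_size (leq j.+1) s; move: (count _ s) => c. lia.
split=> [core b|closed].
  case/mem_beta=> i ltiN eqb; apply/negPn/negP => bX.
  have lt_b : b < nth 0 s i + (N - i.+1) by rewrite -eqb; lia.
  have [j ltj eqbj] := beta_gapP ss leN ltiN lt_b bX.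
  have lti : i < size s.
    by rewrite ltnNge; apply: contraTN ltj => le_i; rewrite nth_default.
  (* The gap [b] is column [j] seen from row [i], and the hook there is exactly 5. *)
  have /allP/(_ i.+1) := core; rewrite mem_iota /= ltnS lti => /(_ isT).
  move/allP/(_ j.+1); rewrite mem_iota /= ltnS /part /= ltj => /(_ isT).
  by have := node i j lti ltj; rewrite -eqbj -eqb addnC => /addnI ->.
apply/allP => -[|i]; rewrite mem_iota //= ltnS => lti.
apply/allP => -[|j]; rewrite mem_iota //= ltnS /part /= => ltj.
(* A hook of length 5 k would lead from an element down to a gap in k steps of 5. *)
apply/negP => /dvdnP [k eq_h]; have := node i j lti ltj; rewrite eq_h.
move: (beta_gap j ss leN) => /negP gap eqb; apply: gap.
have : k * 5 + (N + j - count (leq j.+1) s) \in beta N s.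
  by apply/mem_beta; exists i => //; lia.
move: (N + j - _) => g; elim: k {eq_h eqb} => // k IHk.
by rewrite mulSn -addnA addnC => /closed.
Qed.

(** * Bead counts per residue class and the resulting coordinates *)

Definition resid (r : nat) (X : seq nat) := count (fun b => b %% 5 == r) X.

(** A member a forces 0, ..., a into [Y], whence a < [size Y]; so [Y] lies in the initial segment of
    its own size, and fills it. *)
Lemma mem_down (Y : seq nat) : uniq Y -> (forall a, a.+1 \in Y -> a \in Y) ->
  forall a, (a \in Y) = (a < size Y).
Proof.
move=> uY dY; have sub : {subset Y <= iota 0 (size Y)}.
  move=> a aY; rewrite mem_iota /=.
  have sub_a : {subset iota 0 a.+1 <= Y}.
    move=> b; rewrite mem_iota /= ltnS => leba.
    rewrite -(subKn leba); elim: (a - b) => [|k IHk]; first by rewrite subn0.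
    case: (ltnP k a) => [lt_ka|le_ak]; last first.
      by rewrite (_ : a - k.+1 = a - k) //; lia.
    by apply: dY; rewrite -subSn // subSS.
  by have := uniq_leq_size (iota_uniq 0 a.+1) sub_a; rewrite size_iota.
have le_size : size (iota 0 (size Y)) <= size Y by rewrite size_iota.
have [_ eqY] := uniq_min_size uY sub le_size.
by move=> a; rewrite eqY mem_iota.
Qed.

(** On each runner the quotients by 5 are downward closed, hence an initial segment. A closed set is
    therefore determined by its five counts. *)
Lemma mem_closed5 X b : uniq X -> closed5 X -> (b \in X) = (b %/ 5 < resid (b %% 5) X).
Proof.
move=> uX cX; set r := b %% 5.
pose Y := [seq c %/ 5 | c <- X & c %% 5 == r].
have memY a : (a \in Y) = (a * 5 + r \in X).
  apply/mapP/idP => [[c]|aX].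
    by rewrite mem_filter => /andP[/eqP cr cX'] ->; rewrite -cr -divn_eq.
  exists (a * 5 + r); last by rewrite /r; lia.
  by rewrite mem_filter aX andbT /r; apply/eqP; lia.
have -> : resid r X = size Y by rewrite size_map size_filter.
rewrite -mem_down; first by rewrite memY -divn_eq.
  rewrite map_inj_in_uniq ?filter_uniq // => c d; rewrite !mem_filter.
  case/andP=> /eqP cr _ /andP[/eqP dr _] eqcd.
  by rewrite (divn_eq c 5) (divn_eq d 5) cr dr eqcd.
by move=> a; rewrite !memY mulSn -addnA addnC; apply: cX.
Qed.

Lemma big_closed5 X (F : nat -> nat) : uniq X -> closed5 X ->
  \sum_(b <- X) F b = \sum_(r < 5) \sum_(a < resid r X) F (a * 5 + r).
Proof.
move=> uX cX.
rewrite (partition_big (fun b => inord (b %% 5) : 'I_5) xpredT) //=.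
apply: eq_bigr => r _; rewrite -(big_mkord xpredT (fun a => F (a * 5 + r))).
rewrite -big_filter -[RHS](big_map (fun a => a * 5 + r) xpredT).
apply/perm_big/uniq_perm; first exact: filter_uniq.
  by rewrite map_inj_uniq ?iota_uniq // => a b; lia.
move=> b; rewrite mem_filter mem_closed5 //.
have -> : (inord (b %% 5) == r) = (b %% 5 == r).
  by rewrite -val_eqE /= inordK // ltn_mod.
have ltr := ltn_ord r; apply/andP/mapP => [[/eqP br lt_b]|[a]].
  by exists (b %/ 5); [rewrite mem_index_iota /= -br | rewrite -br -divn_eq].
rewrite mem_index_iota => /= lta ->.
by rewrite divnMDl // modnMDl divn_small // modn_small // addn0.
Qed.

Lemma sum_arith n r : 2 * (\sum_(a < n) (a * 5 + r)) + 5 * n = 5 * n * n + 2 * r * n.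
Proof.
elim: n => [|n IHn]; first by rewrite big_ord0 !muln0.
by rewrite big_ord_recr /=; move: (\sum_(a < n) _) IHn => S; nia.
Qed.

Lemma sum_nth N s : size s <= N -> \sum_(i < N) nth 0 s i = sumn s.
Proof.
elim: s N => [|x s IHs] N; first by rewrite big1 // => i _; rewrite nth_nil.
by case: N => // N; rewrite ltnS big_ord_recl /= => /IHs ->.
Qed.

Lemma sum_beta N s : size s <= N ->
  2 * (\sum_(b <- beta N s) b) + N = 2 * sumn s + N * N.
Proof.
move=> leN; rewrite big_map -{1}[N]subn0 -/(index_iota 0 N) big_mkord big_split /=.
rewrite sum_nth // mulnDr -addnA; congr (_ + _).
elim: N {leN} => [|N IHN]; first by rewrite big_ord0.
rewrite big_ord_recl /= subn1 /=.
by under eq_bigr do rewrite /bump /= add1n subSS; lia.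
Qed.

Lemma partition_size n s : is_partition n s -> size s <= n.
Proof.
case/and3P=> _ s0 /eqP <-; elim: s s0 => //= x s IHs.
by rewrite inE negb_or => /andP[x0 /IHs]; lia.
Qed.

(** A set of 5 M elements has M elements per class on average; subtracting M makes the coordinates
    sum to 0. *)
Definition coords (M : nat) (X : seq nat) : Z5 :=
  let x r : int := ((resid r X)%:Z - M%:Z)%R in (x 0, x 1, x 2, x 3, x 4).

Local Open Scope ring_scope.

(** Here s_r is the sum of the elements of class r, and a, ..., e are the counts. On adding the five
    relations, the total 10 n recentres the coefficients 2 r to 2 (r - 2) and absorbs the shift of
    the counts by 2 n. *)
Lemma core_form_arith (s0 s1 s2 s3 s4 a b c d e n : int) :
  2 * s4 + 5 * e = 5 * e * e + 2 * 4 * e ->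
  2 * s3 + 5 * d = 5 * d * d + 2 * 3 * d ->
  2 * s2 + 5 * c = 5 * c * c + 2 * 2 * c ->
  2 * s1 + 5 * b = 5 * b * b + 2 * 1 * b ->
  2 * s0 + 5 * a = 5 * a * a + 2 * 0 * a ->
  a + (b + (c + (d + e))) = 10 * n ->
  5 * ((a - 2 * n) * (a - 2 * n) + (b - 2 * n) * (b - 2 * n) +
    (c - 2 * n) * (c - 2 * n) + (d - 2 * n) * (d - 2 * n) +
    (e - 2 * n) * (e - 2 * n)) +
   (4 * (e - 2 * n) + 2 * (d - 2 * n) - 2 * (b - 2 * n) - 4 * (a - 2 * n)) +
   10 * n * (10 * n) =
  2 * (s0 + (s1 + (s2 + (s3 + s4)))) + 10 * n.
Proof.
move=> h4 h3 h2 h1 h0 hn.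
have -> : a = 10 * n - (b + (c + (d + e))) by rewrite -hn addrK.
nra.
Qed.

Local Open Scope nat_scope.

Lemma coords_form n X : uniq X -> closed5 X -> size X = 10 * n ->
  tot (coords (2 * n) X) = 0%R /\
  (core_form (coords (2 * n) X) + (10 * n * (10 * n))%:Z =
    (2 * (\sum_(b <- X) b) + 10 * n)%:Z)%R.
Proof.
move=> uX cX; rewrite -sum1_size (big_closed5 _ uX cX) (big_closed5 id uX cX).
under eq_bigr do rewrite sum1_card card_ord.
rewrite /coords /tot /core_form !big_ord_recl !big_ord0 /= /bump /=.
rewrite !(addn0, add1n).
have := sum_arith (resid 0 X) 0; have := sum_arith (resid 1 X) 1.
have := sum_arith (resid 2 X) 2; have := sum_arith (resid 3 X) 3.
have := sum_arith (resid 4 X) 4.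
move: (\sum_(a < resid 0 X) _) (\sum_(a < resid 1 X) _) (\sum_(a < resid 2 X) _)
  (\sum_(a < resid 3 X) _) (\sum_(a < resid 4 X) _) => s0 s1 s2 s3 s4.
move: (resid 0 X) (resid 1 X) (resid 2 X) (resid 3 X) (resid 4 X) => a b c d e.
move=> h4 h3 h2 h1 h0 hn; split; first by lia.
rewrite !(PoszD, PoszM); apply: core_form_arith; rewrite -!(PoszD, PoszM);
  exact: congr1.
Qed.

(** * Reconstruction of a partition from its counts *)

Lemma coef_gen_supp (T : choiceType) (w c : T -> int) (s : seq T) n : uniq s ->
  (forall t, w t = n%:Z -> c t != 0%R -> t \in s) ->
  coef (gen w c) n = (\sum_(t <- s | w t == n%:Z) c t)%R.
Proof.
move=> us sP; rewrite -big_filter fsbig_seq ?filter_uniq //.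
apply/esym/fsbig_widen => [t|t [/= wt]]; rewrite /= mem_filter.
  by case/andP=> /eqP.
by move=> nt; apply/eqP/negPn/negP => /(sP _ wt) ts; apply: nt; rewrite wt eqxx.
Qed.

(* The first nu r terms of each residue class r modulo 5, provided that all the
   nu r are at most K. *)
Definition canon (K : nat) (nu : nat -> nat) : seq nat :=
  [seq b <- rev (iota 0 (K * 5)) | b %/ 5 < nu (b %% 5)].

Lemma canon_sorted K nu : sorted gtn (canon K nu).
Proof.
apply: (sorted_filter gtn_trans); rewrite rev_sorted.
exact: iota_ltn_sorted.
Qed.

Lemma mem_canon K nu b : (forall r, r < 5 -> nu r <= K) ->
  (b \in canon K nu) = (b %/ 5 < nu (b %% 5)).
Proof.
move=> le_nu; rewrite mem_filter mem_rev mem_iota /= add0n andb_idr // => lt_b.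
by rewrite -ltn_divLR //; apply: leq_trans lt_b (le_nu _ _); rewrite ltn_mod.
Qed.

Lemma canon_closed K nu : (forall r, r < 5 -> nu r <= K) -> closed5 (canon K nu).
Proof.
move=> le_nu b; rewrite !mem_canon // modnDr; apply: leq_ltn_trans.
by rewrite leq_div2r // leq_addr.
Qed.

Lemma resid_canon K nu r : (forall r, r < 5 -> nu r <= K) -> r < 5 ->
  resid r (canon K nu) = nu r.
Proof.
move=> le_nu r5; have uX := gtn_sorted_uniq (canon_sorted K nu).
have eq_lt a : (a < nu r) = (a < resid r (canon K nu)).
  have := mem_closed5 (a * 5 + r) uX (canon_closed le_nu).
  by rewrite mem_canon // divnMDl // modnMDl divn_small // modn_small // addn0.
apply/eqP; rewrite eqn_leq leqNgt -eq_lt ltnn /=.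
by rewrite leqNgt eq_lt ltnn.
Qed.

Lemma gtn_sorted_lower X i : sorted gtn X -> i < size X -> size X - i.+1 <= nth 0 X i.
Proof.
elim: X i => //= x X IHX i px; have sX := path_sorted px.
case: i => [|i] /=; last by rewrite ltnS subSS; apply: IHX.
rewrite subSS subn0 => _; case: X px sX IHX => //= y X /andP[ltyx _] sX IHX.
by have := IHX 0 sX isT; rewrite /= subSS subn0 => h; apply: leq_ltn_trans h ltyx.
Qed.

Lemma nth_filter_pos s i : sorted geq s -> nth 0 (filter (leq 1) s) i = nth 0 s i.
Proof.
elim: s i => // x s IHs i px /=; have ss := path_sorted px.
case: x px => [|x] px /=; last by case: i => //= i; apply: IHs.
have s0 : forall y, y \in s -> y = 0.
  by move=> y /(allP (order_path_min geq_trans px)) /=; rewrite leqn0 => /eqP.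
rewrite (eq_in_filter (a2 := pred0)) ?filter_pred0 => [|y /s0 -> //].
rewrite nth_nil; case: i => //= i; case: (ltnP i (size s)) => [lti|le_i].
  by rewrite [RHS]s0 // mem_nth.
by rewrite [RHS]nth_default.
Qed.

(** Subtracting the staircase N - i - 1 from a strictly decreasing sequence leaves a weakly
    decreasing one. Its zero parts are dropped, which [nth] with default 0 does not notice. *)
Lemma betaP X : sorted gtn X ->
  exists s, [/\ sorted geq s, 0 \notin s, size s <= size X & beta (size X) s = X].
Proof.
move=> sX; set N := size X.
pose s' := mkseq (fun i => nth 0 X i - (N - i.+1)) N.
have ss' : sorted geq s'.
  apply/(sortedP 0) => i; rewrite size_mkseq => lti.
  rewrite !nth_mkseq //; last exact: ltnW.
  have := gtn_sorted_lower sX lti; have := gtn_sorted_lower sX (ltnW lti).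
  by have /(sortedP 0)/(_ i lti) := sX; rewrite -/N /=; lia.
exists (filter (leq 1) s'); split.
- exact: (sorted_filter geq_trans).
- by rewrite mem_filter.
- by rewrite size_filter (leq_trans (count_size _ _)) // size_mkseq.
apply: (@eq_from_nth _ 0) => [|i]; rewrite size_beta // => lti.
rewrite nth_beta // nth_filter_pos // nth_mkseq // subnK //.
exact: gtn_sorted_lower.
Qed.

Lemma beta_inj N s s' : 0 \notin s -> 0 \notin s' -> size s <= N -> size s' <= N ->
  beta N s = beta N s' -> s = s'.
Proof.
move=> s0 s0' leN leN' eqb.
have eq_nth i : nth 0 s i = nth 0 s' i.
  case: (ltnP i N) => [lti|le_i]; last first.
    by rewrite !nth_default ?(leq_trans leN) ?(leq_trans leN').
  by have := congr1 (fun X => nth 0 X i) eqb; rewrite !nth_beta // => /addIn.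
have le_size t t' : 0 \notin t' -> (forall i, nth 0 t i = nth 0 t' i) ->
    size t' <= size t.
  move=> t0 eqt; rewrite leqNgt; apply: contra t0 => lt.
  by rewrite -(nth_default 0 (leqnn (size t))) eqt mem_nth.
by apply: (@eq_from_nth _ 0) => // ; apply/eqP; rewrite eqn_leq !le_size.
Qed.

(** * The bijection between 5-cores and lattice points of sum 0 *)

Definition cores5 (n : nat) : seq (seq nat) :=
  [seq seq_of_bseq b | b in [set b : n.-bseq 'I_n.+1 |
    is_partition n (seq_of_bseq b) && is_core 5 (seq_of_bseq b)]].

Lemma size_cores5 n : size (cores5 n) = c5 n.
Proof. by rewrite size_map -cardE. Qed.

Lemma cores5_uniq n : uniq (cores5 n).
Proof. by rewrite map_inj_uniq ?enum_uniq //; apply: seq_of_bseq_inj. Qed.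

Lemma mem_cores5 n s : (s \in cores5 n) = is_partition n s && is_core 5 s.
Proof.
apply/mapP/andP => [[b]|[part_s core_s]].
  by rewrite mem_enum inE => /andP[? ?] ->.
have [b eqb] := partition_bseq part_s; exists b => //.
by rewrite mem_enum inE eqb part_s.
Qed.

(** The number 10 n of beads is a multiple of 5 and bounds the number of parts. The shift 2 n
    matches the lower bound -2 n on the coordinates, so that each point comes from non-negative
    counts. *)
Definition core_coords (n : nat) (s : seq nat) : Z5 :=
  coords (2 * n) (beta (10 * n) s).

Lemma core_coordsP n s : s \in cores5 n ->
  [/\ size s <= 10 * n, 0 \notin s, sorted gtn (beta (10 * n) s),
      closed5 (beta (10 * n) s)
    & tot (core_coords n s) = 0%R /\ core_form (core_coords n s) = (2 * n)%:Z].
Proof.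
rewrite mem_cores5 => /andP[part_s core_s].
have le_s : size s <= 10 * n.
  by apply: leq_trans (partition_size part_s) _; rewrite leq_pmull.
case/and3P: part_s => ss s0 /eqP sum_s.
have sX := beta_sorted (10 * n) ss; have uX := gtn_sorted_uniq sX.
have cX : closed5 (beta (10 * n) s) by apply/is_core_closed.
have [t0 form] := coords_form uX cX (size_beta _ _).
(* With N = 10 n, twice the sum of the beta numbers plus N is 2 n + N^2; the term N^2 cancels. *)
split=> //; move: form; rewrite sum_beta // sum_s.
by rewrite PoszD => /addIr.
Qed.

(** The coordinates give the five counts, these the closed set, and its decreasing order the beta
    numbers. *)
Lemma core_coords_inj n : {in cores5 n &, injective (core_coords n)}.
Proof.
move=> s s' /core_coordsP[le_s s0 sX cX _] /core_coordsP[le_s' s0' sX' cX' _].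
move=> eqc; apply: (beta_inj s0 s0' le_s le_s').
apply: (irr_sorted_eq gtn_trans _ sX sX') => [b|b]; first by rewrite /= ltnn.
rewrite !mem_closed5 ?gtn_sorted_uniq //.
have : b %% 5 < 5 by rewrite ltn_mod.
case: eqc => /addIr[e0] /addIr[e1] /addIr[e2] /addIr[e3] /addIr[e4].
by case: (b %% 5) => [|[|[|[|[|r]]]]] //; rewrite ?e0 ?e1 ?e2 ?e3 ?e4.
Qed.

(** The form is a sum of five terms [thw 5 i x], each at least x^2 and so at least |x|. *)
Lemma core_form_lower (t : Z5) (n : nat) : core_form t = (2 * n)%:Z ->
  let: (a, b, c, d, e) := t in
  [/\ - (2 * n)%:Z <= a, - (2 * n)%:Z <= b, - (2 * n)%:Z <= c,
      - (2 * n)%:Z <= d & - (2 * n)%:Z <= e]%R.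
Proof.
case: t => [[[[a b] c] d] e]; rewrite /core_form; move: (2 * n) => m eqm.
have h0 : (thw 5 (- 4) a + thw 5 (- 2) b + thw 5 0 c + thw 5 2 d + thw 5 4 e = m%:Z)%R.
  by rewrite -eqm /thw; ring.
have ge i x : (-5 < i < 5 -> `|x| <= thw 5 i x)%R.
  by move=> hi; apply: le_trans (thw_ge x hi); nia.
have := ge (- 4)%R a isT; have := ge (- 2)%R b isT; have := ge 0%R c isT.
have := ge 2%R d isT; have := ge 4%R e isT.
move: (thw _ _ _) (thw _ _ _) (thw _ _ _) (thw _ _ _) (thw _ _ _) h0 => u v w x y.
by clear; split; lia.
Qed.

(** Put x + 2 n beads on each runner: there are 10 n in all because the sum is 0, [betaP] yields a
    partition, and the value of the form fixes its size. *)
Lemma core_coords_surj n (t : Z5) : tot t = 0%R -> core_form t = (2 * n)%:Z ->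
  exists2 s, s \in cores5 n & core_coords n s = t.
Proof.
case: t => [[[[a b] c] d] e] t0 form.
have := core_form_lower form; set M := 2 * n => -[ha hb hc hd he].
pose nu r := nth 0 [:: `|(a + M%:Z)%R|%N; `|(b + M%:Z)%R|%N; `|(c + M%:Z)%R|%N;
  `|(d + M%:Z)%R|%N; `|(e + M%:Z)%R|%N] r.
pose K := nu 0 + nu 1 + nu 2 + nu 3 + nu 4.
have le_nu r : r < 5 -> nu r <= K.
  by rewrite /K; case: r => [|[|[|[|[|r]]]]] // _; lia.
pose X := canon K nu.
have sX : sorted gtn X := canon_sorted K nu.
have uX := gtn_sorted_uniq sX; have cX : closed5 X := canon_closed le_nu.
have sizeX : size X = 10 * n.
  rewrite -sum1_size (big_closed5 _ uX cX).
  under eq_bigr do rewrite sum1_card card_ord resid_canon //.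
  rewrite !big_ord_recl big_ord0 /= /bump /= !(addn0, add1n) /nu /=.
  by move: t0; rewrite /tot /M; lia.
have [s [ss s0 le_s eqX]] := betaP sX; rewrite sizeX in le_s eqX.
have coordsX : coords M X = (a, b, c, d, e).
  rewrite /coords !resid_canon // /nu /=.
  by congr (_, _, _, _, _); lia.
exists s; last by rewrite /core_coords eqX.
rewrite mem_cores5; have core_s : is_core 5 s.
  by apply/(is_core_closed ss le_s); rewrite eqX.
rewrite core_s andbT /is_partition ss s0 /=.
have [_] := coords_form uX cX sizeX; rewrite -/M coordsX form -eqX sum_beta //.
by move=> eqn; apply/eqP; lia.
Qed.

Local Open Scope ring_scope.

Lemma coef_core_series_even n : coef core_series (2 * n) = (c5 n)%:Z.
Proof.
rewrite (@coef_gen_supp _ _ _ [seq core_coords n s | s <- cores5 n]).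
- rewrite big_map big_seq_cond.
  rewrite (eq_big (fun s => s \in cores5 n) (fun=> 1)) => [|s|s].
  + by rewrite -big_seq -size_cores5 -[RHS]natz -sum1_size natr_sum.
  + by case: (boolP (s \in _)) => // /core_coordsP[_ _ _ _ [_ ->]]; rewrite eqxx.
  + by case/andP=> /core_coordsP[_ _ _ _ [-> _]] _; rewrite eqxx.
- by rewrite map_inj_in_uniq ?cores5_uniq //; apply: core_coords_inj.
move=> t form; case: (tot t =P 0) => // t0 _.
have [s s_in <-] := core_coords_surj t0 form.
exact: map_f.
Qed.

Lemma core_series_dil : core_series = dil 2 (Fps (fun n => (c5 n)%:Z)).
Proof.
apply/fpsP => n; rewrite coef_dil; case: ifPn => [/dvdnP [m ->]|n_odd].
  by rewrite mulnK // mulnC coef_core_series_even.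
rewrite (@coef_gen_supp _ _ _ [::]) ?big_nil // => t form.
case: (tot t =P 0) => // t0 _.
move: form t0; case: t => [[[[a b] c] d] e] /= form t0.
(* Eliminating a shows that the form is even on points of sum 0, so odd exponents do not occur. *)
have eq_a : a = - (b + c + d + e) by lia.
have : n%:Z = 2 * (5 * (b * b + c * c + d * d + e * e + b * c + b * d + b * e
    + c * d + c * e + d * e) + (2 * e + d - b - 2 * a)).
  by rewrite -form eq_a; ring.
by move: (5 * _ + _) n_odd => y; clear; lia.
Qed.

(** * Relations between the generating functions *)

Definition coreF : fps := Fps (fun n => (c5 n)%:Z).
Definition abarF : fps := Fps abar5.

Notation phi := (theta 1 0).
Notation phi5 := (theta 5 0).
Notation tB := (theta 5 2).
Notation tD := (theta 5 4).

Lemma abarF_phi : abarF * phi = phi5 ^+ 5.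
Proof.
apply/fpsP => n; rewrite theta_5_0 -fps_phi_neg coef_exp.
exact: abar5E.
Qed.

Lemma coreF_dil : dil 2 coreF * phi = phi5 * tB ^+ 2 * tD ^+ 2.
Proof. by rewrite -core_series_dil core_series_phi. Qed.

Lemma theta_neq0 d i : - d < i < d -> theta d i != 0.
Proof. by move=> hi; apply: (@fps_neq0 _ 0); rewrite coef_theta0. Qed.

Lemma fps_natmul_neq0 k : (0 < k)%N -> k%:R != 0 :> fps.
Proof.
by move=> k0; apply: (@fps_neq0 _ 0); rewrite coef_nat pnatr_eq0 -lt0n.
Qed.

Lemma phi_alt : phi * alt phi = dil 2 phi ^+ 2.
Proof. by rewrite (@theta_alt _ _ 0 0) // expr2 {3}dil_theta. Qed.

Lemma theta5_alt k : -5 < 2 * k < 5 ->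
  theta 5 (2 * k) * alt (theta 5 (2 * k)) = dil 2 (theta 5 (2 * k)) * dil 2 phi5.
Proof. by move=> hk; rewrite (@theta_alt _ _ 2 k) // (@dil_theta 2 5 0). Qed.

Lemma phi5_alt : phi5 * alt phi5 = dil 2 phi5 ^+ 2.
Proof. by rewrite expr2; apply: (@theta5_alt 0). Qed.

Lemma tB_alt : tB * alt tB = dil 2 tB * dil 2 phi5.
Proof. exact: (@theta5_alt 1). Qed.

Lemma tD_alt : tD * alt tD = dil 2 tD * dil 2 phi5.
Proof. exact: (@theta5_alt 2). Qed.

Lemma coef0_coreF : coef coreF 0 = 1.
Proof.
have /(congr1 (fun f => coef f 0%N)) := coreF_dil.
by rewrite !expr2 !coef_mul0 !coef_theta0 // !mulr1 coef_dil dvdn0 div0n => ->.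
Qed.

(** Multiplying [coreF_dil] by its image under [alt] makes every factor a series in q^2, by the
    relations for [theta_alt]; undoing q to q^2 leaves an equality of squares. *)
Lemma coreF_phi : coreF * phi = phi5 ^+ 3 * tB * tD.
Proof.
have sqr : (coreF * phi) ^+ 2 = (phi5 ^+ 3 * tB * tD) ^+ 2.
  apply: (@dil_inj 2) => //.
  have h1 := coreF_dil; have h2 := congr1 alt h1.
  rewrite !(rmorphM, rmorphXn) /= alt_dil2 in h2.
  rewrite !(rmorphXn, rmorphM) /=.
  transitivity ((dil 2 coreF * phi) * (dil 2 coreF * alt phi)).
    by rewrite exprMn -phi_alt; ring.
  rewrite h1 h2.
  transitivity ((phi5 * alt phi5) * (tB * alt tB) ^+ 2 * (tD * alt tD) ^+ 2).
    by ring.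
  by rewrite phi5_alt tB_alt tD_alt; ring.
(* Both series have constant term 1, so their sum is nonzero and it is their difference that
   vanishes. *)
apply/eqP; rewrite -subr_eq0; apply/eqP.
apply: (@fps_mulf_eq0 (coreF * phi + phi5 ^+ 3 * tB * tD)).
  apply: (@fps_neq0 _ 0); rewrite coefD !exprS expr0 mulr1 !coef_mul0.
  by rewrite !coef_theta0 // coef0_coreF.
by rewrite mulrC -subr_sqr sqr subrr.
Qed.

(* q C, A^3 p and A p^3. *)
Definition shiftF : fps := fpsX * coreF.
Definition thX : fps := phi5 ^+ 3 * phi.
Definition thY : fps := phi5 * phi ^+ 3.

(** After multiplication by p, the left side is 4 q A^3 B D = A^3 (A^2 - p^2). *)
Lemma shiftF_abarF : 4%:R * shiftF = abarF - thX.
Proof.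
apply: (fps_mulfI (theta_neq0 (_ : - 1 < 0 < 1))) => //.
have := phi_sqr; have := abarF_phi; have := coreF_phi.
rewrite /shiftF /thX => h1 h2 h3.
transitivity (4%:R * fpsX * (coreF * phi)); first by ring.
rewrite h1 mulrBr [phi * abarF]mulrC h2.
transitivity (phi5 ^+ 3 * (4%:R * fpsX * tB * tD)); first by ring.
by rewrite -h3; ring.
Qed.

(** After multiplication by p, the left side is A (4 q B D)^2 = A (A^2 - p^2)^2. *)
Lemma dil_shiftF_abarF :
  16%:R * dil 2 shiftF = abarF - 2%:R * thX + thY.
Proof.
apply: (fps_mulfI (theta_neq0 (_ : - 1 < 0 < 1))) => //.
have := phi_sqr; have := abarF_phi; have := coreF_dil.
rewrite /shiftF /thX /thY rmorphM /= dil_X // => h1 h2 h3.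
transitivity (16%:R * fpsX ^+ 2 * (dil 2 coreF * phi)); first by ring.
rewrite h1; transitivity (phi5 * (4%:R * fpsX * tB * tD) ^+ 2); first by ring.
rewrite -h3; transitivity (abarF * phi - 2%:R * phi5 ^+ 3 * phi ^+ 2 + phi5 * phi ^+ 4).
  by rewrite h2; ring.
by ring.
Qed.

(** * The relation between E(q), E(-q), E(q^2) and E(q^4) *)

Lemma rmorph_rel1 (f : {rmorphism fps -> fps}) (E A p : fps) :
  4%:R * E * p = A ^+ 3 * (A ^+ 2 - p ^+ 2) ->
  4%:R * f E * f p = f A ^+ 3 * (f A ^+ 2 - f p ^+ 2).
Proof. by move/(congr1 f); rewrite !(rmorphXn, rmorphB, rmorph_nat, rmorphM). Qed.

Lemma rmorph_rel2 (f : {rmorphism fps -> fps}) (E A p : fps) :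
  16%:R * E * p = A * (A ^+ 2 - p ^+ 2) ^+ 2 ->
  16%:R * f E * f p = f A * (f A ^+ 2 - f p ^+ 2) ^+ 2.
Proof. by move/(congr1 f); rewrite !(rmorphXn, rmorphB, rmorph_nat, rmorphM). Qed.

(** Multiply by 4 g^2 = 4 p s. The left side becomes A^3 s d + S^3 p e, which [H1], [H2] and
    [sum_AS] turn into a g w (2 a^2 + w); the right side equals this by [D1] and [D2]. *)
Lemma shiftF_alt :
  shiftF + alt shiftF = 2%:R * dil 2 shiftF + 4%:R * dil 2 (dil 2 shiftF).
Proof.
pose A := phi5; pose p := phi; pose S := alt A; pose s := alt p.
pose a := dil 2 A; pose g := dil 2 p; pose w := a ^+ 2 - g ^+ 2.
pose E := shiftF; pose d := A ^+ 2 - p ^+ 2; pose e := S ^+ 2 - s ^+ 2.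
have AS : A * S = a ^+ 2 by apply: phi5_alt.
have ps : p * s = g ^+ 2 by apply: phi_alt.
have p0 : p != 0 by apply: theta_neq0.
have E1 : 4%:R * E * p = A ^+ 3 * d.
  rewrite shiftF_abarF /thX mulrBl abarF_phi /d /A /p; ring.
have E2 : 16%:R * dil 2 E * p = A * d ^+ 2.
  rewrite dil_shiftF_abarF /thX /thY mulrDl mulrBl abarF_phi /d /A /p; ring.
have E1' : 4%:R * alt E * s = S ^+ 3 * e := rmorph_rel1  alt E1.
have E2' : 16%:R * dil 2 E * s = S * e ^+ 2.
  by have := rmorph_rel2  alt E2; rewrite /= alt_dil2.
have D1 : 4%:R * dil 2 E * g = a ^+ 3 * w := rmorph_rel1  (dil 2) E1.
have D2 : 16%:R * dil 2 (dil 2 E) * g = a * w ^+ 2 := rmorph_rel2  (dil 2) E2.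
have dE : d = 4%:R * fpsX * tB * tD by rewrite -phi_sqr /d !expr2.
have altX : alt fpsX = - fpsX.
  apply/fpsP => n; rewrite coef_alt coefN /fpsX /coef /=.
  by case: eqP => [->|_]; rewrite ?mulr1 ?mulr0 ?oppr0.
have de : d * e = - (4%:R * a ^+ 2 * w).
  have -> : e = alt d by rewrite /d rmorphB !rmorphXn.
  have -> : w = dil 2 d by rewrite /d rmorphB !rmorphXn.
  rewrite dE !(rmorphM, rmorph_nat) /= altX dil_X //.
  transitivity (- (16%:R * fpsX ^+ 2 * (tB * alt tB) * (tD * alt tD))); first by ring.
  by rewrite tB_alt tD_alt /a /A; ring.
have d0 : d != 0.
  rewrite dE; apply: (@fps_neq0 _ 1); rewrite -!mulrA coef_natM.
  by rewrite -[fpsX]expr1 coef_XnM /= coef_mul0 !coef_theta0.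
have e0 : e != 0.
  apply: contra_neq d0 => e0; apply/fpsP => n.
  have /(congr1 (fun f => coef f n)) : alt d = 0 by rewrite /d rmorphB !rmorphXn.
  rewrite coef_alt !coef0 => /eqP; rewrite mulf_eq0 => /orP[|/eqP //].
  by rewrite expf_eq0 andbF.
(* Multiplied by d, both sides equal 16 E(q^2) g^2: by [E2] on the left, by [D1] and [de] on the
   right. *)
have H1 : A * s * d = - (a * g * e).
  apply: (fps_mulfI d0); transitivity (s * (A * d ^+ 2)); first by ring.
  rewrite -E2; transitivity (4%:R * (4%:R * dil 2 E * g) * g).
    by transitivity (16%:R * dil 2 E * (p * s)); [ring | rewrite ps; ring].
  rewrite D1; transitivity (- (a * g) * (- (4%:R * a ^+ 2 * w))); first by ring.
  by rewrite -de; ring.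
have H2 : S * p * e = - (a * g * d).
  apply: (fps_mulfI e0); transitivity (p * (S * e ^+ 2)); first by ring.
  rewrite -E2'; transitivity (4%:R * (4%:R * dil 2 E * g) * g).
    by transitivity (16%:R * dil 2 E * (p * s)); [ring | rewrite ps; ring].
  rewrite D1; transitivity (- (a * g) * (- (4%:R * a ^+ 2 * w))); first by ring.
  by rewrite -de; ring.
have g0 : g != 0.
  by apply: contra_neq p0 => g0; apply: (@dil_inj 2) => //; rewrite rmorph0.
(* Everything is expressed through a and w, using g^2 = a^2 - w. *)
have sum_AS : A ^+ 2 * e + S ^+ 2 * d = - (w * (2%:R * a ^+ 2 + w)).
  transitivity (d * e + (A * S) ^+ 2 - (p * s) ^+ 2); first by rewrite /d /e; ring.
  by rewrite de AS ps /w; ring.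
apply: (fps_mulfI g0); apply: (fps_mulfI g0).
apply: (fps_mulfI (fps_natmul_neq0 (_ : 0 < 4)%N)) => //.
transitivity ((4%:R * E * p) * s + (4%:R * alt E * s) * p).
  transitivity (4%:R * (E + alt E) * g ^+ 2); first by rewrite -/E; ring.
  by rewrite -ps; ring.
rewrite E1 E1'.
transitivity (A ^+ 2 * (A * s * d) + S ^+ 2 * (S * p * e)); first by ring.
rewrite H1 H2; transitivity (- (a * g) * (A ^+ 2 * e + S ^+ 2 * d)); first by ring.
rewrite sum_AS; transitivity (2%:R * g * (a ^+ 3 * w) + g * (a * w ^+ 2)); first by ring.
by rewrite -D1 -D2 -/E; ring.
Qed.

(** * The 5-dissections of A^3 p and A p^3 *)

(** Since A = p(q^5), the factor A^3 is a series in q^5, and only the single factor p is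
    dissected. *)
Lemma thX_dissection :
  thX = dil 5 (phi ^+ 3 * phi5) + fpsX * dil 5 (phi ^+ 3 * - (2%:R * tB))
      + fpsX ^+ 2 * dil 5 0 + fpsX ^+ 3 * dil 5 0
      + fpsX ^+ 4 * dil 5 (phi ^+ 3 * (2%:R * tD)).
Proof.
rewrite /thX [in LHS]phi_dissection [in phi5 ^+ 3]theta_5_0.
set U := - (_ * tB); set W := 2%:R * tD; move: phi5 U W phi => A U W p.
by rewrite !(rmorphXn, rmorph0, rmorphM); ring.
Qed.

(** Cube the dissection of p. In the classes 1 and 4 the two contributions combine through p^2 = A^2
    + q U W, giving three times the classes of A^3 p. *)
Lemma thY_dissection (U := - (2%:R * tB)) (W := 2%:R * tD) :
  thY = dil 5 (phi * (phi5 ^+ 3 + 6%:R * phi5 * fpsX * U * W))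
      + fpsX * dil 5 (3%:R * phi * U * phi ^+ 2)
      + fpsX ^+ 2 * dil 5 (phi * (3%:R * phi5 * U ^+ 2 + fpsX ^+ 2 * W ^+ 3))
      + fpsX ^+ 3 * dil 5 (phi * (U ^+ 3 + 3%:R * fpsX * phi5 * W ^+ 2))
      + fpsX ^+ 4 * dil 5 (3%:R * phi * W * phi ^+ 2).
Proof.
have phi_sq : phi ^+ 2 = phi5 ^+ 2 + fpsX * U * W.
  transitivity (phi5 * phi5 - (phi5 * phi5 - phi * phi)); first by ring.
  by rewrite phi_sqr /U /W; ring.
transitivity (dil 5 phi *
    (dil 5 phi5 + fpsX * dil 5 U + fpsX ^+ 4 * dil 5 W) ^+ 3).
  by rewrite -phi_dissection -theta_5_0.
rewrite phi_sq; move: phi5 U W phi {phi_sq} => A U W p.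
by rewrite !(rmorphXn, rmorphD, rmorph_nat, rmorphM) /= dil_X //; ring.
Qed.

Lemma coef_thX_0 n : coef thX (5 * n) = coef thY n.
Proof.
rewrite -[(5 * n)%N]addn0 thX_dissection coef_dissection // /thY.
by congr (coef _ n) => /=; ring.
Qed.

Lemma coef_thX_2 n : coef thX (5 * n + 2) = 0.
Proof. by rewrite thX_dissection coef_dissection. Qed.

Lemma coef_thX_3 n : coef thX (5 * n + 3) = 0.
Proof. by rewrite thX_dissection coef_dissection. Qed.

Lemma coef_thY_1 n : coef thY (5 * n + 1) = 3 * coef thX (5 * n + 1).
Proof.
rewrite thX_dissection thY_dissection !coef_dissection //= -coef_natM.
by congr (coef _ n); ring.
Qed.

Lemma coef_thY_4 n : coef thY (5 * n + 4) = 3 * coef thX (5 * n + 4).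
Proof.
rewrite thX_dissection thY_dissection !coef_dissection //= -coef_natM.
by congr (coef _ n); ring.
Qed.

(** The class 0 component is A p (A^2 - 24 q B D), and 24 q B D = 6 (A^2 - p^2). *)
Lemma coef_thY_0 n : coef thY (5 * n) = 6 * coef thY n - 5 * coef thX n.
Proof.
rewrite -[in LHS](addn0 (5 * n)%N) [in LHS]thY_dissection coef_dissection //=.
rewrite -!coef_natM -coefB /thX /thY; congr (coef _ n).
transitivity (phi * phi5 * (phi5 ^+ 2 - 6%:R * (4%:R * fpsX * tB * tD))); first by ring.
by rewrite -phi_sqr; ring.
Qed.

(** * Coefficient identities *)

Lemma coef_shiftF n : coef shiftF n.+1 = (c5 n)%:Z.
Proof. by rewrite /shiftF -[fpsX]expr1 coef_XnM subn1. Qed.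

Lemma abar5_core n : 4 * (c5 n)%:Z = abar5 n.+1 - coef thX n.+1.
Proof.
by rewrite -coef_shiftF -coef_natM shiftF_abarF coefB.
Qed.

Lemma abar5_dil_shiftF n :
  16 * coef (dil 2 shiftF) n = abar5 n - 2 * coef thX n + coef thY n.
Proof. by rewrite -!coef_natM dil_shiftF_abarF coefD coefB. Qed.

(** In these classes Y = 3 X, so the two relations read 4 E = F - X and 16 E(q^2) = F + X; adding
    them eliminates X. *)
Lemma abar5_mod5_pm1 n : (n %% 5 == 1)%N || (n %% 5 == 4)%N ->
  abar5 n = 2 * coef shiftF n + 8 * coef (dil 2 shiftF) n.
Proof.
move=> hn; have hY : coef thY n = 3 * coef thX n.
  by case/orP: hn => /eqP hn; rewrite (divn_eq n 5) hn mulnC ?coef_thY_1 ?coef_thY_4.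
have := abar5_dil_shiftF n; rewrite hY.
have := congr1 (fun f => coef f n) shiftF_abarF; rewrite coef_natM coefB.
rewrite -[coef abarF n]/(abar5 n); lia.
Qed.

Lemma abar5_odd_pm1 n : (n.+1 %% 5 == 1)%N || (n.+1 %% 5 == 4)%N -> odd n.+1 ->
  abar5 n.+1 = 2 * (c5 n)%:Z.
Proof.
move=> hn n_odd; rewrite abar5_mod5_pm1 // coef_shiftF coef_dil dvdn2 n_odd /=.
by rewrite mulr0 addr0.
Qed.

(** At the exponent 2 m with m odd, E(q) and E(-q) agree and E(q^4) has no term. *)
Lemma coef_shiftF_double m : odd m -> coef shiftF (2 * m) = coef shiftF m.
Proof.
move=> m_odd; have := congr1 (fun f => coef f (2 * m)%N) shiftF_alt.
rewrite !coefD !coef_natM coef_alt !coef_dilM // coef_dil dvdn2 m_odd /=.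
by rewrite exprM sqrrN !expr1n mul1r mulr0 addr0; lia.
Qed.

Lemma abar5_double_pm1 n : odd n.+1 ->
    (2 * n.+1 %% 5 == 1)%N || (2 * n.+1 %% 5 == 4)%N ->
  abar5 (2 * n.+1) = 10 * (c5 n)%:Z.
Proof.
move=> n_odd hn; rewrite abar5_mod5_pm1 // coef_shiftF_double // coef_dilM //.
by rewrite coef_shiftF -mulrDl.
Qed.

(** Apply U to F = 4 (F - X)(q^2) + 2 X - Y. As U commutes with q to q^2, sends X to Y and Y to 6 Y
    - 5 X, the X and Y terms outside q^2 cancel in Z, leaving Z = 4 Z(q^2). *)
Lemma abar5_U5 n :
  abar5 (5 * n)%N = 5 * abar5 n - 5 * coef thX n + coef thY n.
Proof.
have rel k : 4 * coef (dil 2 (abarF - thX)) k = abar5 k - 2 * coef thX k + coef thY k.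
  rewrite -abar5_dil_shiftF -shiftF_abarF rmorphM rmorph_nat /= coef_natM mulrA.
  by [].
pose z n := abar5 (5 * n)%N - (5 * abar5 n - 5 * coef thX n + coef thY n).
have z_even m : z (2 * m)%N = 4 * z m.
  have := rel (2 * m)%N; have := rel (5 * (2 * m))%N.
  rewrite mulnCA !coef_dilM // !coefB -[coef abarF m]/(abar5 m).
  rewrite -[coef abarF (5 * m)]/(abar5 (5 * m)%N) -[in coef thX (2 * _)]mulnCA.
  rewrite -[in coef thY (2 * _)]mulnCA !coef_thX_0 !coef_thY_0 /z mulnCA; lia.
have z_odd k : odd k -> z k = 0.
  move=> k_odd; have := rel k; have := rel (5 * k)%N.
  rewrite !coef_dil !dvdn2 oddM k_odd /= !coef_thX_0 !coef_thY_0 /z; lia.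
suff : z n = 0 by rewrite /z; lia.
elim/ltn_ind: n => n IHn; case: (boolP (odd n)) => [/z_odd //|n_even].
have eqn : n = (2 * n./2)%N by lia.
(* Halving does not decrease 0; there z 0 = 4 z 0 gives the claim. *)
case: (posnP n) => [n0|n_gt0]; last by rewrite eqn z_even IHn ?mulr0 //; lia.
by have := z_even 0%N; rewrite muln0 n0; lia.
Qed.

Lemma abar5_25 n : abar5 (5 * (5 * n))%N = 6 * abar5 (5 * n)%N - 5 * abar5 n.
Proof.
rewrite abar5_U5 coef_thX_0 coef_thY_0; have := abar5_U5 n; lia.
Qed.

(** The recurrence x_(k+2) = 6 x_(k+1) - 5 x_k has characteristic roots 1 and 5. The induction
    carries two consecutive exponents, and the factor 4 keeps the formula integral. *)
Lemma abar5_pow5 n k :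
  4 * abar5 (5 ^ k * n)%N =
  (5 ^+ k - 1) * abar5 (5 * n)%N - (5 ^+ k - 5) * abar5 n.
Proof.
suff : 4 * abar5 (5 ^ k * n)%N =
    (5 ^+ k - 1) * abar5 (5 * n)%N - (5 ^+ k - 5) * abar5 n /\
  4 * abar5 (5 ^ k.+1 * n)%N =
    (5 ^+ k.+1 - 1) * abar5 (5 * n)%N - (5 ^+ k.+1 - 5) * abar5 n by case.
elim: k => [|k [IH1 IH2]].
  by rewrite expn0 mul1n expn1 expr0 expr1; lia.
split=> //; have -> : (5 ^ k.+2 * n = 5 * (5 * (5 ^ k * n)))%N by rewrite !expnS !mulnA.
rewrite abar5_25; rewrite expnS -mulnA in IH2.
rewrite mulrBr mulrCA IH2 [4 * (5 * _)]mulrCA IH1 !exprS.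
by ring.
Qed.

Theorem theorem2 :
  (forall n : nat,
    abar5 (5 * n + 2)%N = 4 * (c5 (5 * n + 1))%:Z /\
    abar5 (5 * n + 3)%N = 4 * (c5 (5 * n + 2))%:Z /\
    abar5 (10 * n + 1)%N = 2 * (c5 (10 * n))%:Z /\
    abar5 (10 * n + 9)%N = 2 * (c5 (10 * n + 8))%:Z /\
    abar5 (20 * n + 6)%N = 10 * (c5 (10 * n + 2))%:Z /\
    abar5 (20 * n + 14)%N = 10 * (c5 (10 * n + 6))%:Z) /\
  (forall n k : nat, (2 <= k)%N ->
    (abar5 (5 ^ k * n)%N)%:~R =
      ((5 ^+ k - 1) / 4) * (abar5 (5 * n)%N)%:~R
        - ((5 ^+ k - 5) / 4) * (abar5 n)%:~R :> rat).
Proof.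
split=> [n|n k _].
  do !split.
  - by rewrite abar5_core -addnS coef_thX_2 subr0.
  - by rewrite abar5_core -addnS coef_thX_3 subr0.
  - by rewrite addn1 abar5_odd_pm1 //; lia.
  - by rewrite addnS abar5_odd_pm1 //; lia.
  (* The last two exponents are doubles of the odd numbers 10 n + 3 and 10 n + 7, and lie in the
     classes 1 and 4 modulo 5. *)
  - rewrite (_ : (20 * n + 6 = 2 * (10 * n + 2).+1)%N); last lia.
    by rewrite abar5_double_pm1 //; lia.
  - rewrite (_ : (20 * n + 14 = 2 * (10 * n + 6).+1)%N); last lia.
    by rewrite abar5_double_pm1 //; lia.
have /(congr1 (fun z : int => z%:~R : rat)) := abar5_pow5 n k.
rewrite !(rmorphB, rmorphM, rmorphXn, rmorph_nat, rmorph1) /= => eq4.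
have nz4 : (4 : rat) != 0 by [].
apply: (mulfI nz4); rewrite eq4; by field.
Qed.
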